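(* Let $T$ be a tree with at least two vertices such that $d(T):=\operatorname{dist}_T(\mathcal S(T),\mathcal C(T))>0$. Choose $s\in\mathcal S(T)$ and $c\in\mathcal C(T)$ with $d_T(s,c)=d(T)$, let $B$ be the connected component of $T-s$ containing $c$, and let $H:=T[V(T)\setminus V(B)]$ be the subgraph induced on the remaining vertices. Then $|V(B)|\ge6$ and $|V(H)|\ge6$. In particular, if $\mathcal S(T)$ and $\mathcal C(T)$ are disjoint, then $|V(T)|\ge12$.
   Context: All graphs are finite, simple and undirected. For a tree $T$ with at least two vertices, $\lambda_1(T)\ge\lambda_2(T)\ge\cdots$ are the eigenvalues of its adjacency matrix $A(T)$ and $0=\mu_1(T)<\mu_2(T)\le\cdots$ those of its Laplacian $L(T)$. Adjacency spectral center: $\mathcal S(T)$ is (the vertex set of) the unique minimal subtree $Y$ of $T$ such that every connected component of $T-Y$ has adjacency spectral radius at most $\lambda_2(T)$. It is known that this is well defined and consists of either one vertex or the two endpoints of one edge. Characteristic set: let $f$ be a Fiedler vector of $T$, i.e. an eigenvector of $L(T)$ for $\mu_2(T)$. It is known that exactly one of the following happens: (1) some entry of $f$ is zero, and then there is a unique vertex $v$ with $f_v=0$ that is adjacent to a vertex $w$ with $f_w\ne0$; in this case $\mathcal C(T)=\{v\}$; (2) no entry of $f$ is zero, and then there is a unique edge $uv$ with $f_u>0>f_v$; in this case $\mathcal C(T)=\{u,v\}$ (a characteristic edge). The set $\mathcal C(T)$ does not depend on the choice of $f$. For nonempty $X,Y\subseteq V(T)$, $\operatorname{dist}_T(X,Y):=\min\{d_T(x,y):x\in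 X,y\in Y\}$, where $d_T$ is the graph distance. *)

(* Defs.v *)
From HB Require Import structures.
From mathcomp Require Import all_boot all_order all_algebra.
From mathcomp Require Import polyrcf.
From mathcomp Require Import reals.

Set Implicit Arguments.
Unset Strict Implicit.
Unset Printing Implicit Defensive.

Import Order.TTheory GRing.Theory Num.Theory.

Local Open Scope ring_scope.

(** A graph is an edge relation [e : rel V] on a finite type of vertices. *)

Section Graphs.
Variable V : finType.
Implicit Types (e : rel V) (X Y : {set V}) (x y : V).

Definition is_simple_graph e : Prop := symmetric e /\ irreflexive e.

Definition is_connected e : Prop := forall x y, connect e x y.

(* The length condition excludes the closed walks x, y, x along one edge. *)
Definition is_acyclic e : Prop :=
  forall p : seq V, (2 < size p)%N -> uniq p -> ~~ cycle e p.

Definition is_tree e : Prop :=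
  [/\ is_simple_graph e, is_connected e & is_acyclic e].

Definition induced e X : rel {x : V | x \in X} :=
  fun a b => e (val a) (val b).

(* The edges of [e] inside [X], as a relation on the whole of [V]. *)
Definition edges_in e X : rel V := [rel x y | [&& x \in X, y \in X & e x y]].

(* The vertex set of the connected component of the induced subgraph on [X]
   that contains [x]; meaningful for [x \in X]. *)
Definition component e X x : {set V} := [set y | connect (edges_in e X) x y].

Definition components e X : {set {set V}} := [set component e X x | x in X].

(* [Y] is the vertex set of a subtree, when [e] is a tree. *)
Definition is_subtree e Y : bool :=
  (Y != set0) && [forall x in Y, forall y in Y, connect (edges_in e Y) x y].

(* The least length of a path from [x] to [y]; in a connected graph such a path
   has length less than [#|V|], the value for unreachable [y]. *)
Definition dist e x y : nat :=
  find (fun n => [exists p : n.-tuple V, path e x p && (last x p == y)])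
       (iota 0 #|V|).

(* The start value [#|V|] is never below a distance, so it plays no role for
   nonempty [X] and [Y]. *)
Definition set_dist e X Y : nat :=
  \big[minn/#|V|]_(x in X) \big[minn/#|V|]_(y in Y) dist e x y.

End Graphs.

(** The real eigenvalues of a square matrix in increasing order, each repeated
    according to its multiplicity in the characteristic polynomial.  For a
    symmetric matrix these are all the eigenvalues. *)
Definition spectrum (R : realType) n (A : 'M[R]_n) : seq R :=
  sort <=%R
    (flatten [seq nseq (mup x (char_poly A)) x | x <- rootsR (char_poly A)]).

Lemma spectrumE (R : realType) n (A : 'M[R]_n) (s : seq R) :
  sorted <=%R s -> char_poly A = \prod_(x <- s) ('X - x%:P) -> spectrum A = s.
Proof.
move=> s_sorted pE; rewrite /spectrum.
have p0 : char_poly A != 0 by rewrite monic_neq0 ?char_poly_monic.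
apply: (sorted_eq le_trans le_anti) => //; first exact: (sort_sorted le_total).
rewrite perm_sort; apply/allP => y _ /=; apply/eqP.
rewrite -(mu_prod_XsubC y s) -pE count_flatten -map_comp sumnE big_map.
under eq_bigr => x _ do rewrite /= count_nseq /=.
have U : uniq (rootsR (char_poly A)) by exact: uniq_roots.
have [yr|yr] := boolP (y \in rootsR (char_poly A)).
  rewrite (bigD1_seq y) //= eqxx mul1n big1 ?addn0 // => x /negPf ->.
  by rewrite mul0n.
rewrite big1_seq => [|x /= xr].
  rewrite mupNroot //; apply: contra yr => yr.
  by rewrite -(roots_on_rootsR p0) yr andbT in_itv.
by case: eqP xr yr => [-> ->|_ _ _]; rewrite ?mul0n.
Qed.

Definition spectral_radius (R : realType) n (A : 'M[R]_n) : R :=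
  \big[Num.max/0]_(x <- spectrum A) `|x|.

Section SpectralCenters.
Variables (R : realType) (V : finType).
Implicit Types (e : rel V) (S C X Y : {set V}) (f : 'cV[R]_#|V|).

Definition adjacency (U : finType) (g : rel U) : 'M[R]_#|U| :=
  \matrix_(i, j) (g (enum_val i) (enum_val j))%:R.

Definition degree e (x : V) : nat := #|[set y | e x y]|.

Definition laplacian e : 'M[R]_#|V| :=
  diag_mx (\row_i (degree e (enum_val i))%:R) - adjacency e.

(* lambda_1 >= lambda_2 >= ... and mu_1 <= mu_2 <= ..., both indexed from 1. *)
Definition lambda e (k : nat) : R := (rev (spectrum (adjacency e)))`_k.-1.

Definition mu e (k : nat) : R := (spectrum (laplacian e))`_k.-1.

Definition bounds_components e Y : bool :=
  [forall X in components e (~: Y),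
     spectral_radius (adjacency (@induced V e X)) <= lambda e 2].

Definition adjacency_center e S : Prop :=
  minset (fun Y => is_subtree e Y && bounds_components e Y) S.

Definition entry f (x : V) : R := f (enum_rank x) 0.

Definition is_fiedler e f : Prop :=
  f != 0 /\ laplacian e *m f = mu e 2 *: f.

Definition characteristic_set_of e f C : Prop :=
     (exists v w, [/\ entry f v = 0, e v w, entry f w != 0 & C = [set v]])
  \/ (forall x, entry f x != 0) /\
     (exists u v, [/\ e u v, 0 < entry f u, entry f v < 0 & C = [set u; v]]).

Definition characteristic_set e C : Prop :=
  exists f, is_fiedler e f /\ characteristic_set_of e f C.

End SpectralCenters.

(* Main.v *)
Require Import Defs.
From HB Require Import structures.
From mathcomp Require Import all_boot all_order all_algebra.
From mathcomp Require Import fingroup perm.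
From mathcomp Require Import ring lra zify complex polyrcf.
From mathcomp Require Import reals.

(** Let b be the neighbour of s in B.  Among the components of T - s other than
    B there is one, K, whose adjacency radius is at least that of B: otherwise a
    combination of the top two eigenvectors vanishing at s would be a
    lambda_2-eigenvector living on B and vanishing at b, against
    Perron-Frobenius.  As rho(K)^2 <= |K| - 1, while rho(B)^2 >= 4 - 6/|B| with
    rho(B)^2 > 3 once |B| >= 6, a small K forces a small B, and |B| >= 6 forces
    |K| >= 5.

    On the Laplacian side, a Fiedler vector f (up to sign) is negative somewhere
    on a branch D at c that avoids s and b, and its negative part g on D is a
    subsolution there for mu_2.  Comparing flows out of the superlevel sets of g
    with those on a path gives mu_2 >= 1/9 if |B| <= 5 and mu_2 >= 1/3 if
    |B| <= 3.  On the other hand g and any function supported on H have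
    non-adjacent supports, so by Courant's principle every such function has
    Rayleigh quotient at least mu_2; an explicit test function on s and K then
    gives mu_2 < 1/9 if |K| >= 4 and mu_2 < 1/3 if |K| >= 2.  This contradicts
    |B| <= 5. *)

Set Implicit Arguments.
Unset Strict Implicit.
Unset Printing Implicit Defensive.

Import Order.TTheory GRing.Theory Num.Theory.

(** * Walks, components and distances *)

Lemma bigminn_le (I : finType) (P : pred I) (F : I -> nat) n i :
  P i -> \big[minn/n]_(j | P j) F j <= F i.
Proof.
have := mem_index_enum i; rewrite -big_filter => ii Pi.
have : i \in [seq j <- index_enum I | P j] by rewrite mem_filter Pi.
elim: [seq _ <- _ | _] => // j s IH; rewrite big_cons inE => /orP[/eqP <-|/IH le_s].
  exact: geq_minl.
exact: leq_trans (geq_minr _ _) le_s.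
Qed.

Lemma bigminn_attained (I : finType) (P : pred I) (F : I -> nat) n :
  \big[minn/n]_(j | P j) F j = n \/ exists2 i, P i & \big[minn/n]_(j | P j) F j = F i.
Proof.
elim/big_rec: _ => [|i m Pi]; first by left.
case: (leqP (F i) m) => _ IH; first by right; exists i.
by case: IH => [->|[j Pj ->]]; [left | right; exists j].
Qed.

Section Walks.
Variables (V : finType) (e : rel V).
Implicit Types (x y u v s c : V) (X Z : {set V}).

Lemma connect_exit (r : rel V) Z x y : connect r x y -> x \in Z -> y \notin Z ->
  exists u v, [/\ u \in Z, v \notin Z & r u v].
Proof.
case/connectP => p; elim: p x => [|z p IH] x /=; first by move=> _ -> ->.
case/andP => rxz pz yE xZ yZ; have [zZ|zZ] := boolP (z \in Z); first exact: (IH z).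
by exists x, z.
Qed.

(** Connectedness of the subgraph on [Z0], phrased by cuts. It is used in this form to locate an
    edge along which a property changes, or to bound a flow from below by one crossing edge. *)
Definition cut_connected Z0 := forall Z, Z \subset Z0 -> Z != set0 -> Z != Z0 ->
  exists u v, [/\ u \in Z, v \in Z0 :\: Z & e u v].

Hypothesis symE : symmetric e.

Lemma edges_in_sym X : symmetric (edges_in e X).
Proof. by move=> x y; rewrite /edges_in /= symE andbCA. Qed.

Lemma edges_in_csym X : connect_sym (edges_in e X).
Proof. exact: sym_connect_sym (edges_in_sym X). Qed.

Lemma mem_component X x : x \in component e X x.
Proof. by rewrite inE connect0. Qed.

Lemma component_sub X x : x \in X -> component e X x \subset X.
Proof.
move=> xX; apply/subsetP => y; rewrite inE => xy; apply: contraT => yX.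
by have [u [v [_ /negP vX /and3P[_ /vX]]]] := connect_exit xy xX yX.
Qed.

Lemma component_edge X x y z :
  y \in component e X x -> y \in X -> z \in X -> e y z -> z \in component e X x.
Proof.
rewrite !inE => xy yX zX yz; apply: connect_trans xy (connect1 _).
by rewrite /edges_in /= yX zX.
Qed.

Lemma component_exit s x y z : x != s ->
  y \in component e (~: [set s]) x -> e y z -> z \notin component e (~: [set s]) x -> z = s.
Proof.
move=> xs yB yz zB; apply/eqP/contraT => zs; move/negP: zB; case.
have xS : x \in ~: [set s] by rewrite !inE.
by apply: component_edge yz => //; [rewrite (subsetP (component_sub xS)) | rewrite !inE].
Qed.

Lemma component_eq X x y : y \in component e X x -> component e X y = component e X x.
Proof.
rewrite inE => xy; apply/setP => z; rewrite !inE.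
by rewrite (same_connect (edges_in_csym X) xy).
Qed.

Lemma component_cut X x : x \in X -> cut_connected (component e X x).
Proof.
move=> xX Z ZD /set0Pn[y yZ] ZnD.
have /subsetPn[z zD zZ] : ~~ (component e X x \subset Z).
  by apply: contra ZnD => DZ; rewrite eqEsubset ZD.
have yD := subsetP ZD _ yZ.
have yz : connect (edges_in e X) y z.
  by move: yD zD; rewrite !inE edges_in_csym; apply: connect_trans.
have [u [v [uZ vZ /and3P[uX vX uv]]]] := connect_exit yz yZ zZ.
exists u, v; split=> //; rewrite inE vZ.
by apply: component_edge uv => //; apply: (subsetP ZD).
Qed.

Lemma dist_le x p : path e x p -> dist e x (last x p) <= size p.
Proof.
move=> pe; rewrite /dist leqNgt; apply/negP => lt_p.
have p_lt : size p < #|V|.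
  by apply: leq_trans lt_p _; rewrite -[X in _ <= X](size_iota 0) find_size.
have := negbT (before_find 0 lt_p); rewrite nth_iota // add0n => /negP[].
by apply/existsP; exists (in_tuple p); rewrite pe eqxx.
Qed.

Lemma dist_path x y : connect e x y ->
  exists p, [/\ path e x p, last x p = y & size p = dist e x y].
Proof.
case/connectP => p0 /shortenP[p pe p_uniq _] {p0} yE.
pose P n := [exists q : n.-tuple V, path e x q && (last x q == y)].
have hasP : has P (iota 0 #|V|).
  apply/hasP; exists (size p); last first.
    by apply/existsP; exists (in_tuple p); rewrite /= pe yE eqxx.
  by rewrite mem_iota add0n /= -[_ < _]/(size (x :: p) <= _) -(card_uniqP p_uniq) max_card.
have := nth_find 0 hasP; rewrite nth_iota; last by rewrite -[X in _ < X](size_iota 0) -has_find.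
rewrite add0n => /existsP[q /andP[qe /eqP qy]].
by exists q; split=> //; rewrite size_tuple.
Qed.

Lemma dist_sym x y : connect e x y -> dist e x y = dist e y x.
Proof.
have le_dist a b : connect e a b -> dist e b a <= dist e a b.
  case/dist_path => p [pe <- <-].
  have := @dist_le (last a p) (rev (belast a p)).
  rewrite rev_path (eq_path (e' := e)) ?pe; last by move=> u v; rewrite /= symE.
  by move/(_ isT); rewrite size_rev size_belast; case: p {pe} => //= z p; rewrite rev_cons last_rcons.
by move=> xy; apply/eqP; rewrite eqn_leq !le_dist // sym_connect_sym.
Qed.

(** A shortest path cannot return to [s], so what follows its first step stays in the graph without
    [s]. *)
Lemma dist_step s c : connect e s c -> s != c ->
  exists b, [/\ e s b, b \in component e (~: [set s]) c & dist e b c < dist e s c].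
Proof.
move=> /dist_path[p [pe pc psz]] sc.
have s_p : s \notin p.
  apply/negP => sp; case/splitPr: sp pe pc psz => p1 p2.
  rewrite cat_path last_cat /= => /and3P[_ _ pe] pc psz.
  have := dist_le pe; rewrite pc -psz size_cat /=.
  by rewrite addnS ltnNge leq_addl.
case: p pe pc psz s_p => [_ /= sc'|b p /= /andP[sb pe] pc psz s_p].
  by rewrite sc' eqxx in sc.
exists b; split=> //; last by rewrite -psz -pc; exact: dist_le.
rewrite inE edges_in_csym; apply/connectP; exists p => //.
elim: p b pe s_p {sb pc psz} => //= z p IH b /andP[bz pe].
rewrite !inE !negb_or => /and3P[sb sz sp].
rewrite /edges_in /= !inE bz (eq_sym b) sb (eq_sym z) sz /=.
by apply: IH; rewrite // inE negb_or sz.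
Qed.

(** The form in which acyclicity is exploited: a branch at [s] hangs on a single edge. *)
Definition unique_entry := forall s a b,
  e s a -> e s b -> connect (edges_in e (~: [set s])) a b -> a = b.

(** A repetition-free path that avoids [s] and joins two distinct neighbours of [s] closes up
    through [s] to a cycle on at least three vertices. *)
Lemma acyclic_unique_entry : is_acyclic e -> unique_entry.
Proof.
move=> acyc s a b sa sb /connectP[p0 /shortenP[p pe p_uniq _]] {p0} bE.
case: p pe p_uniq bE => [|z p] pe p_uniq bE; first by [].
have notin_path q x : path (edges_in e (~: [set s])) x q -> s \notin q.
  elim: q x => //= y q IH x /andP[/and3P[_ yS _] /IH sq].
  by rewrite inE negb_or sq andbT; move: yS; rewrite !inE eq_sym.
have sa' : s != a by move: pe => /= /andP[/and3P[]]; rewrite !inE eq_sym.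
have := acyc (s :: a :: z :: p) isT; rewrite [uniq _]/= -/(uniq (a :: z :: p)) p_uniq andbT.
rewrite inE negb_or sa' (notin_path _ _ pe) => /(_ isT) /negP[].
rewrite /= sa rcons_path /=.
have sub_e q x : path (edges_in e (~: [set s])) x q -> path e x q.
  by apply: sub_path => u v /and3P[].
by move/sub_e: pe => /= /andP[-> ->]; rewrite -[last z p]/(last a (z :: p)) -bE symE.
Qed.

End Walks.

Local Open Scope ring_scope.

(** * The spectral theorem for real symmetric matrices *)

Lemma sum_sqr_mx (R : comPzRingType) n (v : 'rV[R]_n) :
  (v *m v^T) 0 0 = \sum_i v 0 i ^+ 2.
Proof. by rewrite mxE; apply: eq_bigr => i _; rewrite mxE expr2. Qed.

Lemma sum_sqr_eq0 (R : realDomainType) (I : finType) (v : I -> R) :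
  \sum_i v i ^+ 2 = 0 -> forall i, v i = 0.
Proof.
move=> /eqP; rewrite psumr_eq0 => [/allP h i|i _]; last exact: sqr_ge0.
by have := h i (mem_index_enum _); rewrite sqrf_eq0 => /eqP.
Qed.

(** The complex numbers provide an eigenvalue [a]. It is real because, with [w] the conjugate
    transpose of [v], both [v *m w] and [v *m Ac *m w] are invariant under conjugation. As a real
    root of the characteristic polynomial it has a real eigenvector, which is then normalised. *)
Lemma sym_eigenvector (R : rcfType) n (A : 'M[R]_n.+1) : A^T = A ->
  exists r, exists2 v : 'rV[R]_n.+1, v *m A = r *: v & v *m v^T = 1%:M.
Proof.
move=> symA; pose Ac := map_mx (real_complex R) A.
have [a ea] := @eigenvalue_closed R[i] n.+1 Ac isT.
have /eigenvalueP [v vA v0] := ea.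
pose w := map_mx Num.conj v^T.
have a_real : Num.conj a = a.
  have vw0 : (v *m w) 0 0 != 0.
    apply: contra v0; rewrite mxE => /eqP vw0; apply/eqP/rowP => i.
    have: \sum_i `|v 0 i| ^+ 2 == 0.
      by rewrite -[X in _ == X]vw0; apply/eqP/eq_bigr => j _; rewrite !mxE normCK.
    rewrite psumr_eq0 => [/allP/(_ i (mem_index_enum _))|j _]; last first.
      by rewrite exprn_ge0.
    by rewrite sqrf_eq0 normr_eq0 mxE => /eqP.
  have E : (v *m Ac *m w) 0 0 = a * (v *m w) 0 0 by rewrite vA -scalemxAl mxE.
  have conj_w : map_mx Num.conj w^T = v by apply/matrixP => i j; rewrite !mxE conjCK.
  have conj_A : map_mx Num.conj Ac^T = Ac.
    apply/matrixP => i j; rewrite !mxE -{2}symA mxE; exact: conjc_real.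
  have real_vw : Num.conj ((v *m w) 0 0) = (v *m w) 0 0.
    transitivity ((map_mx Num.conj (v *m w)^T) 0 0); first by rewrite !mxE.
    by rewrite trmx_mul map_mxM conj_w.
  have real_vAw : Num.conj ((v *m Ac *m w) 0 0) = (v *m Ac *m w) 0 0.
    transitivity ((map_mx Num.conj (v *m Ac *m w)^T) 0 0); first by rewrite !mxE.
    by rewrite !trmx_mul !map_mxM conj_w conj_A mulmxA.
  by have := real_vAw; rewrite E rmorphM /= real_vw => /(mulIf vw0).
have [r ar] : exists r, a = real_complex R r.
  case: a a_real {ea vA} => x y [/eqP]; rewrite eqNr => /eqP ->; exists x.
  by [].
have: eigenvalue A r.
  by move: ea; rewrite ar !eigenvalue_root_char -map_char_poly fmorph_root.
case/eigenvalueP => u uA u0; exists r.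
pose m := (u *m u^T) 0 0.
have m_gt0 : 0 < m.
  rewrite lt_def /m sum_sqr_mx sumr_ge0 ?andbT; last by move=> i _; exact: sqr_ge0.
  by apply: contra u0 => /eqP /sum_sqr_eq0 h; apply/eqP/rowP => i; rewrite mxE.
exists ((Num.sqrt m)^-1 *: u).
  by rewrite -scalemxAl uA !scalerA mulrC.
rewrite linearZ /= -scalemxAl -scalemxAr scalerA -invfM -expr2 sqr_sqrtr ?ltW //.
by rewrite [u *m _]mx11_scalar -/m scale_scalar_mx mulVf // gt_eqF.
Qed.

(* The reflection exchanging [v] and the first basis vector. *)
Lemma householder (R : rcfType) n (v : 'rV[R]_(1 + n)) : v *m v^T = 1%:M ->
  exists Q : 'M[R]_(1 + n), [/\ Q^T = Q, Q *m Q = 1%:M & delta_mx 0 0 *m Q = v].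
Proof.
move=> vv; pose e1 : 'rV[R]_(1 + n) := delta_mx 0 0.
have [->|vNe] := eqVneq v e1.
  by exists 1%:M; rewrite trmx1 !mulmx1.
pose w := v - e1; pose m := (w *m w^T) 0 0.
have wm : w *m w^T = m%:M by rewrite [LHS]mx11_scalar.
have m0 : m != 0.
  apply: contra vNe; rewrite -[v == e1]subr_eq0 /m sum_sqr_mx => /eqP /sum_sqr_eq0 h.
  by apply/eqP/rowP => i; rewrite [RHS]mxE; exact: h.
have ee : e1 *m e1^T = 1%:M by rewrite trmx_delta mul_delta_mx; apply/matrixP => i j; rewrite !mxE !ord1.
have ve : v *m e1^T = e1 *m v^T.
  by rewrite -[RHS]trmxK trmx_mul trmxK; apply/matrixP => i j; rewrite !mxE !ord1.
(* Since [v] and [e1] are unit vectors, |w|^2 = -2 <e1, w>; hence the reflection moves [e1] by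
   exactly [w]. *)
have ew : 2 / m *: (e1 *m w^T) = - 1%:M.
  have: w *m w^T = - 2%:R *: (e1 *m w^T).
    rewrite /w linearB /= mulmxBl !mulmxBr vv ee ve.
    by rewrite scalerBr; apply/matrixP => i j; rewrite !mxE; ring.
  rewrite wm => E; apply: (scalerI (_ : - m != 0)); first by rewrite oppr_eq0.
  rewrite scalerA mulNr mulrCA mulfV // mulr1 -E scalerN -scaleNr opprK.
  by rewrite scale_scalar_mx mulr1.
exists (1%:M - (2 / m) *: (w^T *m w)); split.
- by rewrite linearB /= trmx1 linearZ /= trmx_mul trmxK.
- have MM : w^T *m w *m (w^T *m w) = m *: (w^T *m w).
    by rewrite -mulmxA [w *m (_ *m _)]mulmxA wm mul_scalar_mx -scalemxAr.
  move: (w^T *m w) MM => M MM.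
  rewrite mulmxBl !mulmxBr !mul1mx !mulmx1 -!scalemxAl -!scalemxAr MM !scalerA.
  rewrite (_ : 2 / m * (2 / m) * m = 2 / m + 2 / m); last by field.
  by rewrite scalerDl opprB addrK subrK.
rewrite mulmxBr mulmx1 -scalemxAr mulmxA scalemxAl -/e1 ew mulNmx mul1mx opprK.
by rewrite /w addrCA subrr addr0.
Qed.

(** Induction on the size: a reflection takes a unit eigenvector to the first basis vector, symmetry
    then clears the first row and column off the diagonal, and the remaining block is again
    symmetric. *)
Lemma sym_spectral (R : rcfType) n (A : 'M[R]_n) : A^T = A ->
  exists P : 'M[R]_n, exists d : 'rV[R]_n,
    P *m P^T = 1%:M /\ P *m A = diag_mx d *m P.
Proof.
elim: n A => [|n IH] A symA.
  by exists 1%:M, 0; split; apply/matrixP => -[].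
have [r [v vA vv]] := sym_eigenvector symA.
have [Q [symQ QQ Qv]] := householder vv.
pose A1 : 'M[R]_(1 + n) := Q *m A *m Q.
have symA1 : A1^T = A1 by rewrite /A1 !trmx_mul symA symQ mulmxA.
have e1A1 : delta_mx (0 : 'I_1) 0 *m A1 = r *: delta_mx 0 0.
  by rewrite /A1 !mulmxA Qv vA -scalemxAl -Qv -mulmxA QQ mulmx1.
have QA : Q *m A = A1 *m Q by rewrite /A1 -mulmxA QQ mulmx1.
clearbody A1.
have A1r j : A1 0 j = r * (0 == j)%:R.
  by have /rowP/(_ j) := e1A1; rewrite -rowE !mxE eqxx eq_sym.
have ls0 : lshift n (0 : 'I_1) = 0 by apply: val_inj.
have A1E : A1 = block_mx r%:M 0 0 (drsubmx A1).
  rewrite -[LHS]submxK; congr block_mx; apply/matrixP => i j; rewrite !mxE ord1 ?ls0.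
  - by rewrite ord1 ls0 A1r eqxx mulr1.
  - by rewrite A1r -[_ == _]/false mulr0.
  - by rewrite -symA1 mxE A1r -[_ == _]/false mulr0.
have symD : (drsubmx A1)^T = drsubmx A1 by rewrite trmx_drsub symA1.
have [P [d [PP PD]]] := IH _ symD.
pose B : 'M[R]_(1 + n) := block_mx 1%:M 0 0 P.
have BB : B *m B^T = 1%:M.
  rewrite tr_block_mx mulmx_block !trmx0 trmx1 PP !mul1mx !mulmx0 !mul0mx !addr0 add0r.
  by rewrite -scalar_mx_block.
have BA : B *m A1 = diag_mx (row_mx r%:M d) *m B.
  rewrite {1}A1E diag_mx_row !mulmx_block !mul1mx !mulmx0 !mul0mx !addr0 !add0r PD mulmx1.
  by congr block_mx; apply/matrixP => i j; rewrite !mxE !ord1.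
exists (B *m Q), (row_mx r%:M d); split.
  by rewrite trmx_mul symQ mulmxA -[_ *m Q *m Q]mulmxA QQ mulmx1.
by rewrite -mulmxA QA !mulmxA -BA.
Qed.

Lemma conj_char_poly (F : fieldType) n (P A D : 'M[F]_n) :
  P \in unitmx -> P *m A = D *m P -> char_poly A = char_poly D.
Proof.
rewrite unitmxE unitfE => P0 PA.
pose Pc := map_mx polyC P.
have PcA : Pc *m char_poly_mx A = char_poly_mx D *m Pc.
  rewrite /char_poly_mx mulmxBr mulmxBl mul_mx_scalar mul_scalar_mx.
  by rewrite -!map_mxM PA.
have Pc0 : \det Pc != 0 by rewrite det_map_mx polyC_eq0.
apply: (mulfI Pc0); rewrite [RHS]mulrC /char_poly -!det_mulmx; congr (\det _).
exact: PcA.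
Qed.

(** The diagonal entries are the roots of the characteristic polynomial, so sorting them gives the
    spectrum; the same permutation of the rows of [P] puts the eigenvectors in that order. *)
Lemma sym_spectrum (R : realType) n (A : 'M[R]_n) : A^T = A ->
  exists P : 'M[R]_n,
    [/\ P *m P^T = 1%:M, size (spectrum A) = n &
        P *m A = diag_mx (\row_i (spectrum A)`_i) *m P].
Proof.
move=> symA; have [P [d [PP PA]]] := sym_spectral symA.
pose t := [tuple d 0 i | i < n].
have /tuple_permP[p Ep] : perm_eq (sort_tuple <=%R t) t by rewrite perm_sort.
have cpA : char_poly A = \prod_(x <- sort_tuple <=%R t) ('X - x%:P).
  rewrite (perm_big t) /=; last by rewrite perm_sort.
  rewrite (conj_char_poly (proj1 (mulmx1_unit PP)) PA) char_poly_trig ?diag_mx_is_trig //.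
  rewrite big_map big_enum /=; apply: eq_bigr => i _.
  by rewrite mxE eqxx mulr1n.
have sE := spectrumE (sort_sorted le_total _ : sorted <=%R (sort_tuple <=%R t)) cpA.
have sEi (i : 'I_n) : (spectrum A)`_i = d 0 (p i).
  rewrite sE Ep -(tnth_nth 0 [tuple tnth t (p i) | i < n] i).
  by rewrite !tnth_mktuple.
exists (row_perm p P); split.
- rewrite tr_row_perm row_permE col_permE mulmxA -[perm_mx p *m P *m P^T]mulmxA PP.
  by rewrite mulmx1 -perm_mxM mulgV perm_mx1.
- by rewrite sE size_tuple.
rewrite !row_permE -mulmxA PA !mulmxA; congr (_ *m _).
apply/matrixP => i j; rewrite -row_permE mul_diag_mx !mxE sEi.
by case: eqP => [->|]; rewrite ?mulr1n ?mulr0n ?mulr1 ?mulr0.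
Qed.

(** * Symmetric matrices as kernels acting on functions of the vertices *)

Lemma reindex_enum_val (R : zmodType) (U : finType) (F : U -> R) :
  \sum_u F u = \sum_(i < #|U|) F (enum_val i).
Proof. by rewrite (reindex (@enum_val U U)) //; apply: onW_bij; exact: enum_val_bij. Qed.

Section Kernels.
Variables (R : realType) (U : finType).
Implicit Types (a : U -> U -> R) (x y z : U -> R).

Definition kernel_mx a : 'M[R]_#|U| := \matrix_(i, j) a (enum_val i) (enum_val j).
Definition kapp a x u := \sum_v a u v * x v.
Definition dotf x y := \sum_u x u * y u.

Lemma dotfC x y : dotf x y = dotf y x.
Proof. by apply: eq_bigr => u _; rewrite mulrC. Qed.

Lemma eq_dotf x x' y y' : x =1 x' -> y =1 y' -> dotf x y = dotf x' y'.
Proof. by move=> xE yE; apply: eq_bigr => u _; rewrite xE yE. Qed.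

Lemma dotfDl x x' y : dotf (fun u => x u + x' u) y = dotf x y + dotf x' y.
Proof. by rewrite -big_split; apply: eq_bigr => u _; rewrite mulrDl. Qed.

Lemma dotfZl c x y : dotf (fun u => c * x u) y = c * dotf x y.
Proof. by rewrite /dotf big_distrr; apply: eq_bigr => u _; rewrite -mulrA. Qed.

Lemma dotfDr x x' y : dotf y (fun u => x u + x' u) = dotf y x + dotf y x'.
Proof. by rewrite !(dotfC y) dotfDl. Qed.

Lemma dotfZr c x y : dotf y (fun u => c * x u) = c * dotf y x.
Proof. by rewrite !(dotfC y) dotfZl. Qed.

Lemma dotf_ge0 x : 0 <= dotf x x.
Proof. by apply: sumr_ge0 => u _; rewrite -expr2 sqr_ge0. Qed.

Lemma dotf_eq0 x : dotf x x = 0 -> x =1 fun=> 0.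
Proof.
move=> h; apply: sum_sqr_eq0; rewrite -[RHS]h.
by apply: eq_bigr => u _; rewrite expr2.
Qed.

Lemma kappD a x y u : kapp a (fun v => x v + y v) u = kapp a x u + kapp a y u.
Proof. by rewrite -big_split; apply: eq_bigr => v _; rewrite mulrDr. Qed.

Lemma kappZ a c x u : kapp a (fun v => c * x v) u = c * kapp a x u.
Proof. by rewrite /kapp big_distrr; apply: eq_bigr => v _; rewrite mulrCA. Qed.

Lemma eq_kapp a x y : x =1 y -> kapp a x =1 kapp a y.
Proof. by move=> h u; apply: eq_bigr => v _; rewrite h. Qed.

Variable a : U -> U -> R.
Hypothesis symA : forall u v, a u v = a v u.
Local Notation s := (spectrum (kernel_mx a)).

Lemma kapp_sym x y : dotf x (kapp a y) = dotf (kapp a x) y.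
Proof.
rewrite /dotf; under eq_bigr => u _ do rewrite big_distrr /=.
rewrite exchange_big; apply: eq_bigr => v _; rewrite /kapp big_distrl /=.
by apply: eq_bigr => u _; rewrite symA; ring.
Qed.

(** The rows of the diagonalising matrix [P], read as functions on [U]. Orthonormality is
    [P *m P^T = 1%:M]; the third clause, Parseval's identity, is [P^T *m P = 1%:M]. *)
Lemma eigenbasis : exists p : 'I_#|U| -> U -> R,
  [/\ size s = #|U|,
      forall i j, dotf (p i) (p j) = (i == j)%:R,
      forall x y, dotf x y = \sum_i dotf x (p i) * dotf y (p i) &
      forall i, kapp a (p i) =1 fun u => s`_i * p i u].
Proof.
have sym : (kernel_mx a)^T = kernel_mx a by apply/matrixP => i j; rewrite !mxE symA.
have [P [PP sz PA]] := sym_spectrum sym.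
have P'P := mulmx1C PP.
have dotE x i : dotf x (fun u => P i (enum_rank u)) =
    ((\row_i x (enum_val i)) *m P^T) 0 i.
  rewrite /dotf reindex_enum_val mxE; apply: eq_bigr => k _.
  by rewrite !mxE enum_valK.
exists (fun i u => P i (enum_rank u)); split=> //.
- move=> i j; rewrite dotE; have /matrixP/(_ i j) := PP; rewrite [RHS]mxE => <-.
  by rewrite !mxE; apply: eq_bigr => k _; rewrite !mxE enum_valK.
- move=> x y; under eq_bigr => i _ do rewrite !dotE.
  pose X : 'rV[R]_#|U| := \row_i x (enum_val i).
  pose Y : 'rV[R]_#|U| := \row_i y (enum_val i).
  have E : X *m P^T *m (Y *m P^T)^T = X *m Y^T.
    by rewrite trmx_mul trmxK -mulmxA [P^T *m _]mulmxA P'P mul1mx.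
  have /matrixP/(_ 0 0) := E; rewrite mxE [RHS]mxE => E00.
  rewrite /dotf reindex_enum_val; transitivity (\sum_k X 0 k * Y^T k 0).
    by apply: eq_bigr => k _; rewrite !mxE.
  by rewrite -E00; apply: eq_bigr => k _; congr (_ * _); rewrite mxE.
move=> i u; have /matrixP/(_ i (enum_rank u)) := PA.
rewrite mul_diag_mx !mxE => <-.
rewrite /kapp reindex_enum_val; apply: eq_bigr => k _.
by rewrite !mxE enum_valK enum_rankK symA mulrC.
Qed.

End Kernels.

(** * Rayleigh quotients and the spectral radius *)

Section Variational.
Variables (R : realType) (U : finType) (a : U -> U -> R).
Hypothesis symA : forall u v, a u v = a v u.
Implicit Types (x y : U -> R).
Local Notation s := (spectrum (kernel_mx a)).
Local Notation rho := (spectral_radius (kernel_mx a)).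

Lemma spectrum_le i j : (i <= j < size s)%N -> s`_i <= s`_j.
Proof.
case/andP => ij js; have sorted_s : sorted <=%O s by exact: sort_sorted le_total _.
by apply: (le_sorted_leq_nth 0 sorted_s); rewrite ?inE // (leq_ltn_trans ij).
Qed.

Lemma radius_ge (i : nat) : (i < size s)%N -> `|s`_i| <= rho.
Proof.
by move=> lt_i; rewrite /spectral_radius; apply: le_bigmax_seq => //; exact: mem_nth.
Qed.

Lemma radius_attained : rho = 0 \/ exists2 i, (i < size s)%N & rho = `|s`_i|.
Proof.
rewrite /spectral_radius.
suff [->|[x /(nthP 0)[i lt_i <-] ->]] : \big[Num.max/0]_(x <- s) `|x| = 0 \/
    exists2 x, x \in s & \big[Num.max/0]_(x <- s) `|x| = `|x|.
- by left.
- by right; exists i.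
elim: s => [|x t IH]; first by left; rewrite big_nil.
rewrite big_cons maxEle; case: ifP => _; last by right; exists x; rewrite ?mem_head.
by case: IH => [|[y yt ->]]; [left | right; exists y; rewrite // inE yt orbT].
Qed.

Lemma kapp_form_coord (p : 'I_#|U| -> U -> R) i x :
  kapp a (p i) =1 (fun u => s`_i * p i u) ->
  dotf (kapp a x) (p i) = s`_i * dotf x (p i).
Proof.
by move=> E; rewrite -kapp_sym // (eq_dotf (x' := x) _ E) // dotfZr.
Qed.

(** Each coordinate in the eigenbasis is scaled by at most [rho] in absolute value. Bounding the
    norm of the image, rather than the quadratic form, lets sums of squared degrees bound the radius
    from below. *)
Lemma kapp_norm_le x : dotf (kapp a x) (kapp a x) <= rho ^+ 2 * dotf x x.
Proof.
have [p [sz _ pars eig]] := eigenbasis symA.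
rewrite !pars big_distrr /=; apply: ler_sum => i _.
rewrite !(kapp_form_coord _ (eig i)) -!expr2 exprMn ler_wpM2r ?sqr_ge0 //.
rewrite -(real_normK (num_real s`_i)) lerXn2r ?nnegrE //.
  by apply: le_trans (radius_ge (i := i) _); rewrite ?sz.
by apply: radius_ge; rewrite sz.
Qed.

Lemma kapp_form_le x : dotf (kapp a x) x <= rho * dotf x x.
Proof.
have [p [sz _ pars eig]] := eigenbasis symA.
rewrite !pars big_distrr /=; apply: ler_sum => i _.
rewrite !(kapp_form_coord _ (eig i)) -mulrA -expr2 ler_wpM2r ?sqr_ge0 //.
by apply: le_trans (ler_norm _) _; apply: radius_ge; rewrite sz.
Qed.

(** The radius is a maximum of absolute values, so the eigenvalue attaining it is determined only up
    to sign. *)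
Lemma radius_eigenfunction : 0 < rho -> exists r, exists x,
  [/\ `|r| = rho, dotf x x = 1 & kapp a x =1 fun u => r * x u].
Proof.
have [p [sz orth pars eig]] := eigenbasis symA.
case: radius_attained => [->|[i lt_i ->] _]; first by rewrite ltxx.
rewrite sz in lt_i; exists s`_i, (p (Ordinal lt_i)); split=> //.
by rewrite orth eqxx.
Qed.

(* Some combination of [x] and [y] is orthogonal to the first eigenfunction;
   its Rayleigh quotient forces the coefficient of [y] to vanish. *)
Lemma second_eigenfunction x y : (1 < #|U|)%N ->
  dotf (kapp a y) y < s`_1 * dotf y y -> dotf (kapp a x) x <= s`_1 * dotf x x ->
  dotf (kapp a x) y = 0 -> dotf x y = 0 ->
  kapp a x =1 fun u => s`_1 * x u.
Proof.
move=> U1 qy qx xay xy; have [p [sz orth pars eig]] := eigenbasis symA.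
have kf := fun i z => kapp_form_coord z (eig i).
pose i0 : 'I_#|U| := Ordinal (ltnW U1).
have form_ge z : dotf z (p i0) = 0 -> s`_1 * dotf z z <= dotf (kapp a z) z.
  move=> z0; rewrite !pars big_distrr /=; apply: ler_sum => i _; rewrite kf -mulrA.
  have [->|i_n0] := eqVneq i i0; first by rewrite z0 !mulr0.
  rewrite -expr2 ler_wpM2r ?sqr_ge0 // spectrum_le // sz ltn_ord andbT.
  by rewrite lt0n; apply: contra i_n0 => /eqP i0E; apply/eqP/val_inj.
pose al := dotf x (p i0); pose be := dotf y (p i0).
(* This combination is orthogonal to the bottom eigenfunction, and the mixed terms of its norm and
   form vanish by the orthogonality of [x] and [y]. *)
pose z u := be * x u + - al * y u.
have zz : dotf z z = be ^+ 2 * dotf x x + al ^+ 2 * dotf y y.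
  rewrite /z !dotfDl !dotfDr !dotfZl !dotfZr (dotfC y x) xy; ring.
have yax : dotf (kapp a y) x = 0 by rewrite -kapp_sym // dotfC.
have zaz : dotf (kapp a z) z = be ^+ 2 * dotf (kapp a x) x + al ^+ 2 * dotf (kapp a y) y.
  have E : kapp a z =1 fun u => be * kapp a x u + - al * kapp a y u.
    by move=> u; rewrite kappD !kappZ.
  rewrite (eq_dotf E (fun u => erefl)) /z !dotfDl !dotfDr !dotfZl !dotfZr xay yax; ring.
have z0 : dotf z (p i0) = 0 by rewrite /z dotfDl !dotfZl -/al -/be; ring.
have := form_ge z z0; rewrite zz zaz => le1.
(* Otherwise [y] itself would be orthogonal to the bottom eigenfunction, against its small Rayleigh
   quotient. *)
have be0 : be != 0.
  by apply/eqP => be0; have := form_ge y be0; rewrite leNgt qy.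
have al0 : al = 0.
  apply/eqP; case: eqVneq => // al0.
  have := mulr_gt0 (_ : 0 < al ^+ 2) (_ : 0 < s`_1 * dotf y y - dotf (kapp a y) y).
  rewrite subr_gt0 qy => /(_ _ isT); rewrite exprn_even_gt0 //= al0 => /(_ isT) h.
  have := mulr_ge0 (sqr_ge0 be) (_ : 0 <= s`_1 * dotf x x - dotf (kapp a x) x).
  rewrite subr_ge0 qx => /(_ isT); lra.
have xax : dotf (kapp a x) x = s`_1 * dotf x x by apply/le_anti; rewrite qx form_ge.
(* As [al] is zero, no term of this sum is negative; so [x] has coordinates only along the second
   eigenvalue. *)
have tight : \sum_(i < #|U|) (s`_i - s`_1) * dotf x (p i) ^+ 2 = 0.
  transitivity (dotf (kapp a x) x - s`_1 * dotf x x); last by rewrite xax subrr.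
  rewrite !pars big_distrr -sumrB; apply: eq_bigr => i _.
  by rewrite kf /=; ring.
have term_ge0 (i : 'I_#|U|) : 0 <= (s`_i - s`_1) * dotf x (p i) ^+ 2.
  have [->|i_n0] := eqVneq i i0; first by rewrite [dotf _ _]al0 expr0n mulr0.
  rewrite mulr_ge0 ?sqr_ge0 // subr_ge0 spectrum_le // sz ltn_ord andbT.
  by rewrite lt0n; apply: contra i_n0 => /eqP i0E; apply/eqP/val_inj.
have term0 (i : 'I_#|U|) : (s`_i - s`_1) * dotf x (p i) = 0.
  move/eqP: tight; rewrite psumr_eq0 => [/allP/(_ i (mem_index_enum _))|//].
  by rewrite mulf_eq0 sqrf_eq0 -mulf_eq0 => /eqP.
pose w u := kapp a x u + - s`_1 * x u.
have w0 : dotf w w = 0.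
  rewrite pars big1 // => i _.
  have -> : dotf w (p i) = (s`_i - s`_1) * dotf x (p i).
    by rewrite /w dotfDl dotfZl kf; ring.
  by rewrite term0 mulr0.
by move=> u; have := dotf_eq0 w0 u; rewrite /w mulNr => /eqP; rewrite subr_eq0 => /eqP.
Qed.

(** Eigenfunctions for the two largest eigenvalues span a plane, in which some nonzero function
    vanishes at [u0]. Equality in the lower bound for its Rayleigh quotient means that the top
    coefficient is zero or that the two eigenvalues agree. *)
Lemma two_top_eigenfunctions u0 : (1 < #|U|)%N -> exists x,
  [/\ 0 < dotf x x, x u0 = 0, (rev s)`_1 * dotf x x <= dotf (kapp a x) x &
      dotf (kapp a x) x <= (rev s)`_1 * dotf x x ->
      kapp a x =1 fun u => (rev s)`_1 * x u].
Proof.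
move=> U1; have [p [sz orth pars eig]] := eigenbasis symA.
rewrite nth_rev ?sz //.
have lt_i : (#|U| - 2 < #|U|)%N by lia.
have lt_j : (#|U| - 1 < #|U|)%N by lia.
pose i := Ordinal lt_i; pose j := Ordinal lt_j.
have sij : s`_i <= s`_j by apply: spectrum_le; rewrite sz lt_j leq_sub2l.
have ij : (i == j) = false.
  have ne n : (1 < n)%N -> (n - 2 == n - 1)%N = false by lia.
  exact: ne.
rewrite -[(_ - 2)%N]/(val i).
have [b [c [bc0 bc]]] : exists b c, 0 < b ^+ 2 + c ^+ 2 /\ b * p i u0 + c * p j u0 = 0.
  have [pi0|pi0] := eqVneq (p i u0) 0.
    by exists 1, 0; split; [rewrite expr1n expr0n addr0 | rewrite pi0 !(mulr0, mul0r) addr0].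
  exists (p j u0), (- p i u0); split; last by ring.
  by rewrite ltr_wpDl ?sqr_ge0 // sqrrN exprn_even_gt0.
pose x u := b * p i u + c * p j u.
have xx : dotf x x = b ^+ 2 + c ^+ 2.
  rewrite /x !dotfDl !dotfDr !dotfZl !dotfZr !orth !eqxx (eq_sym j) ij /=; ring.
have ax : kapp a x =1 fun u => (b * s`_i) * p i u + (c * s`_j) * p j u.
  by move=> u; rewrite kappD !kappZ !eig !mulrA.
have xax : dotf (kapp a x) x = b ^+ 2 * s`_i + c ^+ 2 * s`_j.
  rewrite (eq_dotf ax (fun u => erefl)) /x.
  rewrite !dotfDl !dotfDr !dotfZl !dotfZr !orth !eqxx (eq_sym j) ij /=; ring.
have gap : 0 <= c ^+ 2 * (s`_j - s`_i) by rewrite mulr_ge0 ?sqr_ge0 ?subr_ge0.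
exists x; rewrite xx xax; split=> //; first by lra.
move=> le1 u; have : c ^+ 2 * (s`_j - s`_i) = 0 by lra.
rewrite ax => /eqP; rewrite mulf_eq0 sqrf_eq0 subr_eq0 => /orP[] /eqP E; rewrite /x E /=.
  by ring.
by ring.
Qed.

End Variational.

(** * Adjacency radius of trees *)

Section EdgeCount.
Variables (U : finType) (g : rel U).
Hypothesis symG : symmetric g.

(** Send a walk u, w, v to its end v, or to w if it returns to u. The image avoids u, and the map is
    injective because each branch at u contains only one neighbour of u. *)
Lemma two_walks_le u : irreflexive g -> is_acyclic g ->
  (#|[set p : U * U | g u p.1 && g p.1 p.2]| <= #|U|.-1)%N.
Proof.
move=> irrG acyc; have entry := acyclic_unique_entry symG acyc.
pose f (p : U * U) := if p.2 == u then p.1 else p.2.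
have ne x y : g x y -> x != y by apply: contraTneq => ->; rewrite irrG.
have step w v : g u w -> v != u -> g w v -> connect (edges_in g (~: [set u])) w v.
  move=> uw vu wv; apply: connect1; rewrite /edges_in /= !inE vu wv.
  by rewrite eq_sym (ne _ _ uw).
rewrite -(card_in_imset (f := f)).
  rewrite -(cardsC1 u); apply/subset_leq_card/subsetP => _ /imsetP[[w v] /= + ->].
  rewrite !inE /f /= => /andP[uw wv].
  by case: (eqVneq v u) => // _; rewrite eq_sym ne.
move=> [w v] [w' v']; rewrite !inE /f /= => /andP[uw wv] /andP[uw' wv'].
case: (eqVneq v u) (eqVneq v' u) => [->|vu] [->|v'u].
- by move=> ->.
- move=> E; subst w; have := entry u w' v' uw' uw (step _ _ uw' v'u wv').
  by move=> E; rewrite E irrG in wv'.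
- move=> E; subst w'; have := entry u w v uw uw' (step _ _ uw vu wv).
  by move=> E; rewrite E irrG in wv.
move=> E; subst v'; congr (_, _); apply: (entry u) => //.
apply: connect_trans (step _ _ uw vu wv) _.
by rewrite edges_in_csym //; exact: step.
Qed.

(** A vertex set is grown one vertex at a time along a cut edge; each new vertex brings at least one
    edge, counted in both directions. *)
Lemma degree_sum_ge : cut_connected g setT -> (2 * #|U|.-1 <= \sum_u degree g u)%N.
Proof.
move=> cut; pose E (Z : {set U}) := [set p | [&& p.1 \in Z, p.2 \in Z & g p.1 p.2]].
have grow k : (k < #|U|)%N -> exists2 Z : {set U}, #|Z| = k.+1 & (2 * k <= #|E Z|)%N.
  elim: k => [|k IH] lt_k.
    by case/card_gt0P: lt_k => u _; exists [set u]; rewrite ?cards1.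
  have [Z Zk EZ] := IH (ltnW lt_k).
  have [u [v [uZ vZ uv]]] : exists u v, [/\ u \in Z, v \in setT :\: Z & g u v].
    apply: cut; rewrite ?subsetT -?card_gt0 ?Zk //.
    by apply/eqP => ZT; rewrite -Zk ZT cardsT ltnn in lt_k.
  rewrite !inE andbT in vZ; exists (v |: Z); first by rewrite cardsU1 vZ Zk.
  have uv_ne : (u, v) != (v, u).
    by apply: contraNneq vZ => -[<-].
  have : (v, u) |: ((u, v) |: E Z) \subset E (v |: Z).
    apply/subsetP => -[x y]; rewrite !inE !xpair_eqE /=.
    case/or3P => [/andP[/eqP-> /eqP->]|/andP[/eqP-> /eqP->]|/and3P[-> -> ->]].
    - by rewrite eqxx uZ orbT symG.
    - by rewrite eqxx uZ orbT.
    - by rewrite !orbT.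
  move/subset_leq_card; rewrite !cardsU1 !inE /= (negbTE vZ) !andbF orbF.
  rewrite eq_sym (negbTE uv_ne) /=; apply: leq_trans.
  by rewrite addnA mulnS leq_add2l.
case: (posnP #|U|) => [->//|U_gt0].
have [|Z Zn EZ] := grow #|U|.-1; first by rewrite prednK.
apply: leq_trans EZ _; rewrite prednK // in Zn.
have -> : \sum_u degree g u = #|[set p : U * U | g p.1 p.2]|.
  rewrite (eq_bigr (fun u => \sum_(v | g u v) 1)%N) => [|u _].
    by rewrite pair_big_dep /= sum1dep_card.
  by rewrite /degree -sum1dep_card.
by apply: subset_leq_card; apply/subsetP => p; rewrite !inE => /and3P[].
Qed.

End EdgeCount.

(** * Bounds on the adjacency radius in terms of the number of vertices *)

Section Radius.
Variables (R : realType) (U : finType) (g : rel U).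
Hypothesis symG : symmetric g.
Local Notation rho := (spectral_radius (adjacency R g)).
Let a (u v : U) : R := (g u v)%:R.

Lemma adjacency_kernel : adjacency R g = kernel_mx a.
Proof. by []. Qed.

Let symA u v : a u v = a v u.
Proof. by rewrite /a symG. Qed.

Lemma radius_ge0 : 0 <= rho.
Proof.
rewrite adjacency_kernel.
by case: (radius_attained a) => [->|[i _ ->]].
Qed.

(** The squared eigenvalue equation is read at a vertex where the eigenfunction is largest in
    absolute value: a row sum of the squared adjacency matrix counts walks of length two. *)
Lemma radius_sqr_le : irreflexive g -> is_acyclic g -> (0 < #|U|)%N ->
  rho ^+ 2 <= (#|U|.-1)%:R.
Proof.
move=> irrG acyc /card_gt0P[u1 _].
have [rho0|rho_gt0] := leP rho 0.
  by rewrite (_ : rho = 0) ?expr0n ?ler0n //; apply/le_anti; rewrite rho0 radius_ge0.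
have [r [x [rE xx rx]]] := radius_eigenfunction symA rho_gt0.
have [u _ max_u] : exists2 u, true & forall v, `|x v| <= `|x u|.
  have [u _ h] := @arg_maxP _ _ _ u1 xpredT (fun u => `|x u|) isT.
  by exists u => // v; exact: h.
have xu_gt0 : 0 < `|x u|.
  rewrite normr_gt0; apply/eqP => xu0; have := xx.
  rewrite /dotf big1 => [/eqP|v _]; first by rewrite eq_sym oner_eq0.
  by have := max_u v; rewrite xu0 normr0 normr_le0 => /eqP ->; rewrite mulr0.
rewrite -(ler_pM2r xu_gt0) -adjacency_kernel -/rho in rE *.
rewrite -rE -normrX -normrM.
have -> : r ^+ 2 * x u = \sum_w \sum_v a u w * a w v * x v.
  rewrite expr2 -mulrA -rx -(kappZ a r x).
  rewrite -(eq_kapp _ rx) /kapp; apply: eq_bigr => w _.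
  by rewrite big_distrr /=; apply: eq_bigr => v _; rewrite mulrA.
apply: le_trans (_ : \sum_w \sum_v (g u w && g w v)%:R * `|x u| <= _).
  apply: le_trans (ler_norm_sum _ _ _) _; apply: ler_sum => w _.
  apply: le_trans (ler_norm_sum _ _ _) _; apply: ler_sum => v _.
  by rewrite /a -natrM mulnb normrM normr_nat ler_wpM2l ?ler0n.
under eq_bigr => w _ do rewrite -big_distrl /=.
rewrite -big_distrl /= ler_wpM2r //.
under eq_bigr => w _ do rewrite -natr_sum.
rewrite -natr_sum ler_nat; apply: leq_trans (two_walks_le symG u irrG acyc).
rewrite -sum1dep_card (pair_bigA _ (fun w v => nat_of_bool (g u w && g w v))) /=.
by rewrite [X in (_ <= X)%N]big_mkcond; apply: leq_sum => -[w v] _ /=; case: ifP.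
Qed.

Let deg u : R := (degree g u)%:R.

Lemma kapp_one u : kapp a (fun=> 1) u = deg u.
Proof.
rewrite /kapp /deg /degree -sum1dep_card natr_sum [RHS]big_mkcond.
by apply: eq_bigr => v _; rewrite mulr1 /a; case: (g u v).
Qed.

Lemma deg_sum_ge : cut_connected g setT -> (0 < #|U|)%N ->
  2 * #|U|%:R - 2 <= \sum_u deg u.
Proof.
move=> cut U0; have := degree_sum_ge symG cut.
rewrite -(ler_nat R) natr_sum natrM => h; apply: le_trans h.
by rewrite -{1}(prednK U0) mulrSr; lra.
Qed.

(** This is (d - 1)(d - 2) >= 0, valid because d is a natural number. *)
Lemma sqr_deg_ge (u : U) : 3 * deg u - 2 <= deg u ^+ 2.
Proof.
rewrite /deg; case: (degree g u) => [|[|d]]; [lra | lra |].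
by rewrite -addn2 natrD; have := ler0n R d; nra.
Qed.

(** Test function 1: the sum of squared degrees is at least 3 (2n - 2) - 2n. *)
Lemma radius_sqr_ge : cut_connected g setT -> (0 < #|U|)%N ->
  4 * #|U|%:R - 6 <= rho ^+ 2 * #|U|%:R.
Proof.
move=> cut U0; have := kapp_norm_le symA (fun=> 1).
rewrite -adjacency_kernel /dotf; under [X in X <= _]eq_bigr => u _ do rewrite !kapp_one.
under [X in _ <= _ * X]eq_bigr => u _ do rewrite mulr1.
rewrite sumr_const -[#|predT|]/(#|U|) => le1; apply: le_trans le1.
have := deg_sum_ge cut U0 => le2.
have: \sum_u (3 * deg u - 2) <= \sum_u deg u * deg u.
  by apply: ler_sum => u _; rewrite -expr2 sqr_deg_ge.
rewrite sumrB -big_distrr sumr_const -[#|predT|]/(#|U|) /= -[2 *+ _]mulr_natr; lra.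
Qed.

(** For n = 6 the constant test function gives only the weak inequality. Lowering its value at a
    leaf to 1/2 yields (4n - 31/4) / (n - 3/4), which exceeds 3 as soon as n > 11/2. Without a leaf
    all degrees are at least 2 and the constant function already gives 4. *)
Lemma radius_sqr_gt3 : cut_connected g setT -> (6 <= #|U|)%N -> 3 < rho ^+ 2.
Proof.
move=> cut U6; have U0 : (0 < #|U|)%N by exact: leq_trans U6.
have n6 : 6 <= #|U|%:R :> R by rewrite ler_nat.
have [/existsP[l degl]|no_leaf] := boolP [exists l, (degree g l <= 1)%N].
  pose x u : R := 1 + - (1 / 2) * (u == l)%:R.
  have sum_eq (F : U -> R) : \sum_u F u * (u == l)%:R = F l.
    rewrite (bigD1 l) //= eqxx mulr1 big1 ?addr0 // => u /negbTE ->.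
    by rewrite mulr0.
  have ax u : kapp a x u = deg u - 1 / 2 * a u l.
    by rewrite /x kappD kappZ kapp_one /kapp sum_eq mulNr.
  have xx : dotf x x = #|U|%:R - 3 / 4.
    rewrite /dotf (eq_bigr (fun u => 1 + - (3 / 4) * (u == l)%:R)) => [|u _].
      by rewrite big_split sumr_const -[#|predT|]/(#|U|) /= (sum_eq (fun=> _)).
    by rewrite /x; case: (u == l); rewrite ?mulr1 ?mulr0; field.
  have := kapp_norm_le symA x; rewrite -adjacency_kernel xx => le1.
  have le2 : \sum_u (3 * deg u - 2 - 7 / 4 * a u l) <= dotf (kapp a x) (kapp a x).
    apply: ler_sum => u _; rewrite ax /a; case: (g u l); last first.
      by rewrite !mulr0 !subr0 -expr2 sqr_deg_ge.
    (* At a neighbour of the leaf the two sides differ by exactly this square. *)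
    by rewrite !mulr1; have := sqr_ge0 (deg u - 2); nra.
  have le3 := deg_sum_ge cut U0.
  have le4 : \sum_u a u l <= 1.
    under eq_bigr => u _ do rewrite symA -[a l u]mulr1.
    by rewrite -[X in X <= _]/(kapp a (fun=> 1) l) kapp_one /deg lern1.
  move: le2; rewrite !sumrB -!big_distrr sumr_const -[#|predT|]/(#|U|) /= -[2 *+ _]mulr_natr.
  move=> le2; rewrite ltNge; apply/negP => le5.
  have := ler_wpM2r (_ : 0 <= #|U|%:R - 3 / 4) le5; lra.
have deg2 u : 2 <= deg u.
  rewrite /deg ler_nat ltnNge; apply: contra no_leaf => du.
  by apply/existsP; exists u.
have := kapp_norm_le symA (fun=> 1).
rewrite -adjacency_kernel /dotf; under [X in X <= _]eq_bigr => u _ do rewrite !kapp_one.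
under [X in _ <= _ * X]eq_bigr => u _ do rewrite mulr1.
rewrite sumr_const -[#|predT|]/(#|U|) => le1.
have: \sum_(u : U) 4 <= \sum_u deg u * deg u.
  by apply: ler_sum => u _; have := deg2 u; nra.
rewrite sumr_const -[#|predT|]/(#|U|) -[4 *+ _]mulr_natr => le2.
rewrite ltNge; apply/negP => le5.
have := ler_wpM2r (_ : 0 <= #|U|%:R) le5; lra.
Qed.

End Radius.

(** * Radii of induced subgraphs and the branches at a vertex *)

Section Induced.
Variables (R : realType) (V : finType) (e : rel V).
Hypothesis symE : symmetric e.
Implicit Types (X : {set V}) (x y : V -> R).
Let a (u v : V) : R := (e u v)%:R.
Local Notation rad X := (spectral_radius (adjacency R (@induced V e X))).

Let symA u v : a u v = a v u.
Proof. by rewrite /a symE. Qed.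

Lemma induced_sym X : symmetric (@induced V e X).
Proof. by move=> u v; rewrite /induced symE. Qed.

Lemma card_induced X : #|{: {x : V | x \in X}}| = #|X|.
Proof. by rewrite card_sig; apply: eq_card. Qed.

Lemma induced_acyclic X : is_acyclic e -> is_acyclic (@induced V e X).
Proof.
move=> acyc p p2 p_uniq; have := acyc (map val p).
rewrite size_map p2 (map_inj_uniq val_inj) p_uniq => /(_ isT isT); apply: contra.
case: p {p2 p_uniq} => //= u p; rewrite -map_rcons.
by move: {p}(rcons p u) => q; elim: q u => //= v q IH u /andP[uv /IH ->]; rewrite andbT.
Qed.

Lemma induced_cut X : cut_connected e X -> cut_connected (@induced V e X) setT.
Proof.
move=> cut Z _ /set0Pn[z zZ] ZT.
have [w wZ] : exists w, w \notin Z.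
  apply/existsP; rewrite -negb_forall; apply: contra ZT => /forallP h.
  by apply/eqP/setP => w; rewrite h inE.
have [u [v [/imsetP[u0 u0Z ->] vD uv]]] :
    exists u v, [/\ u \in val @: Z, v \in X :\: val @: Z & e u v].
  apply: cut.
  - by apply/subsetP => _ /imsetP[u _ ->]; exact: valP.
  - by apply/set0Pn; exists (val z); exact: imset_f.
  - apply: contra wZ => /eqP ZX; have : val w \in val @: Z by rewrite ZX (valP w).
    by case/imsetP => u uZ /val_inj ->.
move: vD; rewrite inE => /andP[vZ vX]; exists u0, (Sub v vX); split=> //.
by rewrite !inE andbT; apply: contra vZ => vZ; apply/imsetP; exists (Sub v vX).
Qed.

Lemma sum_support X (F : V -> R) : (forall u, u \notin X -> F u = 0) ->
  \sum_u F u = \sum_(u : {u : V | u \in X}) F (val u).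
Proof.
move=> F0; rewrite -(big_sub X F) [RHS]big_mkcond.
by apply: eq_bigr => u _; case: ifPn => // /F0.
Qed.

Lemma induced_form_le X x : (forall u, u \notin X -> x u = 0) ->
  dotf (kapp a x) x <= rad X * dotf x x.
Proof.
move=> x0; pose xr (u : {u : V | u \in X}) := x (val u).
have symX u v : ((@induced V e X u v)%:R : R) = (@induced V e X v u)%:R.
  by rewrite induced_sym.
have := kapp_form_le symX xr; rewrite -adjacency_kernel.
have -> : dotf xr xr = dotf x x.
  by rewrite /dotf (sum_support (X := X)) // => u /x0 ->; rewrite mulr0.
suff -> : dotf (kapp (fun u v => ((@induced V e X u v)%:R : R)) xr) xr = dotf (kapp a x) x by [].
rewrite /dotf [RHS](sum_support (X := X)); last by move=> u /x0 ->; rewrite mulr0.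
apply: eq_bigr => u _; congr (_ * _).
by rewrite /kapp (sum_support (X := X)) // => v /x0 ->; rewrite mulr0.
Qed.

(** By contradiction: a function from the top two eigenfunctions that vanishes at [s] splits into
    pieces on the branches. If all branches other than that of [c] were light, only the piece there
    could survive, and it would vanish at [b]. *)
Lemma other_heavy_component s c b : (1 < #|V|)%N -> irreflexive e -> unique_entry e ->
  c != s -> e s b -> b \in component e (~: [set s]) c ->
  rad (component e (~: [set s]) c) <= lambda R e 2 ->
  exists2 X, X \in components e (~: [set s]) &
    X != component e (~: [set s]) c /\ lambda R e 2 <= rad X.
Proof.
move=> V1 irrE entry cs sb bB radB; set B := component _ _ _ in bB radB *.
set l := lambda R e 2 in radB *.
have [/existsP[X /and3P[]]|none] :=
  boolP [exists X in components e (~: [set s]), (X != B) && (l <= rad X)].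
  by exists X.
have light X : X \in components e (~: [set s]) -> X != B -> rad X < l.
  move=> XC XB; rewrite ltNge; apply: contra none => lX.
  by apply/existsP; exists X; rewrite XC XB.
have cS : c \in ~: [set s] by rewrite !inE.
have [x [x_gt0 xs form_ge eigx]] := two_top_eigenfunctions symA s V1.
rewrite -adjacency_kernel -[(rev _)`_1]/l in form_ge eigx.
pose xX (X : {set V}) u := if u \in X then x u else 0.
pose comps := components e (~: [set s]).
have sum_comps (F : V -> R) : F s = 0 ->
    \sum_u F u = \sum_(X in comps) \sum_(u in X) F u.
  move=> Fs; rewrite (bigD1 s) //= Fs add0r.
  rewrite (partition_big (component e (~: [set s])) (mem comps)) /=; last first.
    by move=> u us; apply/imsetP; exists u; rewrite // !inE.
  apply: eq_bigr => _ /imsetP[w wS ->]; apply: eq_bigl => u.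
  apply/andP/idP => [[us /eqP <-]|uw]; first exact: mem_component.
  have := subsetP (component_sub e wS) _ uw; rewrite !inE => us.
  by rewrite us (component_eq symE uw).
(* A neighbour of [u] outside its branch can only be [s], where [x] vanishes. *)
have kapp_comp X u : X \in comps -> u \in X -> kapp a x u = kapp a (xX X) u.
  case/imsetP => w wS -> uw; rewrite /kapp; apply: eq_bigr => v _; rewrite /xX.
  case: ifPn => // vw; rewrite /a mulr0; case: (boolP (e u v)) => uv; last by rewrite mul0r.
  have ws : w != s by move: wS; rewrite !inE.
  by rewrite (component_exit ws uw uv vw) xs mulr0.
have dot_comp X F : dotf F (xX X) = \sum_(u in X) F u * x u.
  rewrite /dotf [RHS]big_mkcond; apply: eq_bigr => u _; rewrite /xX.
  by case: ifP => //; rewrite mulr0.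
have xX_xX X : dotf (xX X) (xX X) = \sum_(u in X) x u * x u.
  by rewrite dot_comp; apply: eq_bigr => u uX; rewrite /xX uX.
have form_sum : dotf (kapp a x) x = \sum_(X in comps) dotf (kapp a (xX X)) (xX X).
  rewrite {1}/dotf sum_comps ?xs ?mulr0 //; apply: eq_bigr => X XC.
  by rewrite dot_comp; apply: eq_bigr => u uX; rewrite (kapp_comp X).
have norm_sum : dotf x x = \sum_(X in comps) dotf (xX X) (xX X).
  by rewrite {1}/dotf sum_comps ?xs ?mulr0 //; apply: eq_bigr => X _; rewrite xX_xX.
have form_X X : dotf (kapp a (xX X)) (xX X) <= rad X * dotf (xX X) (xX X).
  by apply: induced_form_le => u /negbTE uX; rewrite /xX uX.
have form_Xl X : X \in comps -> dotf (kapp a (xX X)) (xX X) <= l * dotf (xX X) (xX X).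
  move=> XC; apply: le_trans (form_X X) _; rewrite ler_wpM2r ?dotf_ge0 //.
  by have [->|/(light X XC)/ltW] := eqVneq X B.
have ax : kapp a x =1 fun u => l * x u.
  apply: eigx; rewrite form_sum norm_sum big_distrr /=.
  exact: ler_sum.
have xX0 X u : X \in comps -> X != B -> u \in X -> x u = 0.
  move=> XC XB uX.
  have E : dotf (kapp a (xX X)) (xX X) = l * dotf (xX X) (xX X).
    rewrite xX_xX dot_comp big_distrr; apply: eq_bigr => v vX.
    by rewrite -(kapp_comp X) // ax -mulrA.
  have := form_X X; rewrite E => le1; have lt1 := light X XC XB.
  have : dotf (xX X) (xX X) = 0.
    apply/eqP; case: eqVneq => // n0; have g0 : 0 < dotf (xX X) (xX X).
      by rewrite lt_def n0 dotf_ge0.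
    by move: le1; rewrite ler_pM2r // leNgt lt1.
  by move/dotf_eq0/(_ u); rewrite /xX uX.
have supp u : u \notin B -> x u = 0.
  move=> uB; have [->//|us] := eqVneq u s.
  apply: (xX0 (component e (~: [set s]) u)); last exact: mem_component.
    by apply/imsetP; exists u; rewrite // !inE.
  by apply: contra uB => /eqP <-; exact: mem_component.
(* The eigenvalue equation at [s]: [b] is the only neighbour of [s] at which [x] may be nonzero. *)
have xb : x b = 0.
  have := ax s; rewrite xs mulr0 /kapp (bigD1 b) //= /a sb mul1r big1 ?addr0 // => v vb.
  case: (boolP (e s v)) => sv; last by rewrite mul0r.
  have [vB|/supp ->] := boolP (v \in B); last by rewrite mulr0.
  case/eqP: vb; apply: entry sv sb _; move: vB bB; rewrite !inE => cv cb.
  by apply: connect_trans cb; rewrite edges_in_csym.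
(* Perron-Frobenius by hand: passing to absolute values keeps the norm and does not lower the
   form. *)
pose y u := `|x u|.
have yy : dotf y y = dotf x x.
  by apply: eq_bigr => u _; rewrite -!expr2 /y real_normK ?num_real.
have yay : l * dotf x x <= dotf (kapp a y) y.
  apply: le_trans form_ge _; apply: le_trans (ler_norm _) _.
  apply: le_trans (ler_norm_sum _ _ _) _; apply: ler_sum => u _.
  rewrite normrM ler_wpM2r //; apply: le_trans (ler_norm_sum _ _ _) _.
  by apply: ler_sum => v _; rewrite normrM /a normr_nat.
(* On the connected set [B] the function [x] vanishes at [b] but not everywhere, so some zero [u] is
   adjacent to a nonzero [v]. *)
have [u [v [uZ vZ uv]]] : exists u v,
    [/\ u \in [set u in B | x u == 0], v \in B :\: [set u in B | x u == 0] & e u v].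
  apply: (component_cut symE cS).
  - by apply/subsetP => u; rewrite inE => /andP[].
  - by apply/set0Pn; exists b; rewrite inE bB xb eqxx.
  apply/eqP => /setP ZB; move: x_gt0; rewrite /dotf big1 ?ltxx // => u _.
  have [uB|/supp ->] := boolP (u \in B); last by rewrite mulr0.
  by have := ZB u; rewrite -/B in_set uB => /eqP ->; rewrite mulr0.
have /andP[uB /eqP xu0] : (u \in B) && (x u == 0) by move: uZ; rewrite in_set.
have /andP[vB xv0] : (v \in B) && (x v != 0).
  by move: vZ; rewrite in_setD in_set -/B => /andP[+ vB]; rewrite vB.
have yu0 : y u = 0 by rewrite /y xu0 normr0.
pose al := kapp a y u.
have al_gt0 : 0 < al.
  rewrite /al /kapp (bigD1 v) //= /a uv mul1r ltr_wpDr ?normr_gt0 //.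
  by apply: sumr_ge0 => w _; rewrite mulr_ge0 ?ler0n ?normr_ge0.
(* Raising [y] at [u] by [t] adds [2 * t * al] to the form but only [t ^+ 2] to the squared norm.
   This [t] satisfies [l * t <= al], whereas the bound on the radius of [B] would require
   [2 * al <= l * t]. The summand 1 keeps the denominator positive. *)
pose t := al / (`|l| + 1).
have l1_gt0 : 0 < `|l| + 1 by rewrite ltr_wpDl.
have t_gt0 : 0 < t by rewrite divr_gt0.
pose d w : R := (w == u)%:R.
have dotd F : dotf F d = F u.
  rewrite /dotf (bigD1 u) //= /d eqxx mulr1 big1 ?addr0 // => w /negbTE ->.
  by rewrite mulr0.
pose z w := y w + t * d w.
have zB w : w \notin B -> z w = 0.
  move=> wB; rewrite /z /y supp // normr0 /d.
  by case: eqP wB => [->|]; rewrite ?uB // mulr0 addr0.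
have := le_trans (induced_form_le zB) (ler_wpM2r (dotf_ge0 z) radB).
have az : kapp a z =1 fun w => kapp a y w + t * kapp a d w.
  by move=> w; rewrite kappD kappZ.
have ad0 : kapp a d u = 0 by rewrite /kapp -/(dotf (a u) d) dotd /a irrE.
have -> : dotf z z = dotf y y + t ^+ 2.
  rewrite /z dotfDl !dotfDr !dotfZl !dotfZr !dotd (dotfC d) dotd yu0 /d eqxx /=; ring.
have -> : dotf (kapp a z) z = dotf (kapp a y) y + 2 * t * al.
  rewrite (eq_dotf az (fun w => erefl)) /z dotfDl !dotfDr !dotfZl !dotfZr !dotd.
  rewrite -(kapp_sym symA d y) (dotfC d) dotd ad0 -/al; ring.
rewrite yy mulrDr => le1.
have le2 : 2 * al <= l * t by rewrite -(ler_pM2r t_gt0); lra.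
have le3 : l * t <= al.
  rewrite /t mulrCA -[leRHS]mulr1 (ler_wpM2l (ltW al_gt0)) //.
  by rewrite ler_pdivrMr // mul1r; apply: le_trans (ler_norm l) _; rewrite lerDl.
by lra.
Qed.

End Induced.

(** * Laplacian subsolutions *)

Lemma sum_indicator (R : realType) (V : finType) (A : {set V}) (w : R) :
  \sum_u w * (u \in A)%:R = w * #|A|%:R.
Proof.
rewrite -big_distrr /=; congr (_ * _); rewrite -sum1_card natr_sum [RHS]big_mkcond.
by apply: eq_bigr => u _; case: (u \in A).
Qed.

Lemma sum2_indicator (R : realType) (V : finType) (A A' : {set V}) (w : R) :
  \sum_u \sum_v w * ((u \in A)%:R * (v \in A')%:R) = w * (#|A|%:R * #|A'|%:R).
Proof.
rewrite mulrA -(sum_indicator A w) big_distrl; apply: eq_bigr => u _ /=.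
by under eq_bigr => v _ do rewrite mulrA; rewrite sum_indicator.
Qed.

Section Laplacian.
Variables (R : realType) (V : finType) (e : rel V).
Hypothesis symE : symmetric e.
Implicit Types (x y g : V -> R) (U : {set V}).
Local Notation a u v := ((e u v)%:R : R).

Definition lap (u v : V) : R := (degree e u)%:R * (u == v)%:R - a u v.

Lemma laplacian_kernel : laplacian R e = kernel_mx lap.
Proof.
apply/matrixP => i j; rewrite !mxE /lap (inj_eq enum_val_inj).
by rewrite mulr_natr; case: eqP => // ->.
Qed.

Lemma lap_sym u v : lap u v = lap v u.
Proof. by rewrite /lap symE eq_sym; case: (eqVneq v u) => [->|]; rewrite ?mulr0. Qed.

Lemma kapp_lap x u : kapp lap x u = \sum_v a u v * (x u - x v).
Proof.
have -> : \sum_v a u v * (x u - x v) = (degree e u)%:R * x u - \sum_v a u v * x v.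
  under eq_bigr => v _ do rewrite mulrBr.
  rewrite sumrB -big_distrl /=; congr (_ * _ - _).
  rewrite /degree -sum1dep_card natr_sum [RHS]big_mkcond.
  by apply: eq_bigr => v _; case: (e u v).
rewrite /kapp /lap; under eq_bigr => v _ do rewrite mulrBl.
rewrite sumrB; congr (_ - _).
rewrite (bigD1 u) //= eqxx mulr1 big1 ?addr0 // => v vu.
by rewrite eq_sym (negbTE vu) mulr0 mul0r.
Qed.

Lemma lap_form x : 2 * dotf (kapp lap x) x = \sum_u \sum_v a u v * (x u - x v) ^+ 2.
Proof.
have E : dotf (kapp lap x) x = \sum_u \sum_v a u v * (x u - x v) * x u.
  by apply: eq_bigr => u _; rewrite kapp_lap big_distrl.
rewrite mulr2n mulrDl mul1r {2}E exchange_big E -big_split; apply: eq_bigr => u _.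
by rewrite -big_split; apply: eq_bigr => v _; rewrite (symE v u) /=; ring.
Qed.

Lemma fiedler_eigenfunction (f : 'cV[R]_#|V|) : is_fiedler e f ->
  kapp lap (entry f) =1 (fun u => mu R e 2 * entry f u) /\ exists u, entry f u != 0.
Proof.
case=> f0 /matrixP Lf; split.
  move=> u; have := Lf (enum_rank u) 0; rewrite [RHS]mxE laplacian_kernel.
  rewrite /entry => <-; rewrite mxE /kapp reindex_enum_val; apply: eq_bigr => i _.
  by rewrite !mxE enum_rankK enum_valK.
apply/existsP; apply: contra_neqT f0 => /existsPn f0; apply/matrixP => i j.
rewrite [RHS]mxE ord1; have := f0 (enum_val i); rewrite negbK /entry enum_valK.
by move/eqP.
Qed.

Hypothesis cutV : cut_connected e setT.

(** The sum is the net flow out of [U]: terms inside [U] cancel in pairs, those across the boundary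
    are nonnegative, and at least one edge crosses it. *)
Lemma lap_cut U x al be : U != set0 -> U != setT -> be <= al ->
  (forall u, u \in U -> al <= x u) -> (forall v, v \notin U -> x v <= be) ->
  al - be <= \sum_(u in U) kapp lap x u.
Proof.
move=> U0 UT be_al xU xU'.
have [u0 [v0 [u0U v0U uv]]] := cutV (subsetT U) U0 UT.
rewrite inE inE andbT in v0U.
have -> : \sum_(u in U) kapp lap x u =
    \sum_(u in U) \sum_(v in U) a u v * (x u - x v) +
    \sum_(u in U) \sum_(v in ~: U) a u v * (x u - x v).
  rewrite -big_split; apply: eq_bigr => u _; rewrite kapp_lap (bigID (mem U)) /=.
  by congr (_ + _); apply: eq_bigl => v; rewrite inE.
have -> : \sum_(u in U) \sum_(v in U) a u v * (x u - x v) = 0.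
  set S := LHS; have : S = - S.
    rewrite /S {1}exchange_big -sumrN; apply: eq_bigr => u _.
    by rewrite -sumrN; apply: eq_bigr => v _; rewrite (symE v u); ring.
  by lra.
have ge0 u v : u \in U -> v \in ~: U -> 0 <= a u v * (x u - x v).
  rewrite inE => uU vU; rewrite mulr_ge0 ?ler0n // subr_ge0.
  by apply: le_trans (xU' _ vU) (le_trans be_al (xU _ uU)).
have v0U' : v0 \in ~: U by rewrite inE.
rewrite add0r (bigD1 u0) //= (bigD1 v0) //= uv mul1r.
apply: le_trans (_ : x u0 - x v0 <= _); first by rewrite lerB ?xU ?xU'.
rewrite -addrA lerDl addr_ge0 //; first by apply: sumr_ge0 => v /andP[vU _]; exact: ge0.
by apply: sumr_ge0 => u /andP[uU _]; apply: sumr_ge0 => v vU; exact: ge0.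
Qed.

(** * Nonnegative subsolutions: lower bounds on the eigenvalue and separation of supports *)

Section Subsolution.
Variables (m : R) (g : V -> R).
Hypotheses (g_ge0 : forall u, 0 <= g u) (gm : forall u, 0 < g u -> kapp lap g u <= m * g u).
Local Notation supp := [set u | 0 < g u].
Hypotheses (g_n0 : supp != set0) (g_nT : supp != setT).

Let g0 u : u \notin supp -> g u = 0.
Proof. by rewrite inE -leNgt => gu; apply/le_anti; rewrite gu g_ge0. Qed.

Lemma subsolution_form : dotf (kapp lap g) g <= m * dotf g g.
Proof.
rewrite /dotf big_distrr; apply: ler_sum => u _ /=.
have [|/g0 ->] := boolP (u \in supp); last by rewrite !mulr0.
by rewrite inE => gu; rewrite mulrA ler_wpM2r ?gm.
Qed.

(* The values of [g] in decreasing order satisfy the inequalities that hold on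
   a path leaving the support of [g]: the flow out of a superlevel set crosses
   at least one edge. *)
Lemma decreasing_rearrangement : exists t : nat -> R,
  [/\ 0 < t 0, forall i, 0 <= t i, forall i, (#|supp| <= i)%N -> t i = 0 &
      forall i, t i - t i.+1 <= m * \sum_(j < i.+1) t j].
Proof.
have [u0 _] := set0Pn _ g_n0.
pose ge := [rel u v | g v <= g u].
have ge_trans : transitive ge by move=> y x z /= xy yz; exact: le_trans yz xy.
(* The positive values of [g] in decreasing order, continued by zeros. *)
pose T := sort ge (enum supp); pose t i := if (i < size T)%N then g (nth u0 T i) else 0.
have sT : size T = #|supp| by rewrite size_sort cardE.
have memT u : (u \in T) = (u \in supp) by rewrite mem_sort mem_enum.
have uniqT : uniq T by rewrite sort_uniq enum_uniq.
have sorted_T : sorted ge T by apply: sort_sorted => u v; exact: le_total.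
have T_anti i j : (i <= j < size T)%N -> g (nth u0 T j) <= g (nth u0 T i).
  case/andP => ij jT.
  by apply: (sorted_leq_nth ge_trans (fun u => lexx (g u)) u0 sorted_T); rewrite ?inE ?(leq_ltn_trans ij).
have t_ge0 i : 0 <= t i by rewrite /t; case: ifP.
exists t; split=> //.
- rewrite /t sT card_gt0 g_n0; have : nth u0 T 0 \in supp.
    by rewrite -memT mem_nth // sT card_gt0.
  by rewrite inE.
- by move=> i; rewrite /t sT ltnNge => ->.
move=> i; have flow U : U != set0 -> U \subset supp -> forall al be, be <= al ->
    (forall u, u \in U -> al <= g u) -> (forall v, v \notin U -> g v <= be) ->
    al - be <= m * \sum_(u in U) g u.
  move=> U0 US al be be_al gU gU'.
  apply: le_trans (lap_cut U0 _ be_al gU gU') _.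
    apply: contra g_nT => /eqP UT; apply/eqP/setP => u.
    by rewrite [RHS]inE (subsetP US) // UT inE.
  rewrite big_distrr; apply: ler_sum => u uU /=; apply: gm.
  by have := subsetP US _ uU; rewrite inE.
(* The flow out of the whole support is nonnegative; this settles the indices past the last positive
   value. *)
have m_ge0 : 0 <= m.
  have := flow supp g_n0 (subxx _) 0 0 (lexx _) (fun u _ => g_ge0 u).
  have le0 v : v \notin supp -> g v <= 0 by move/g0 ->.
  rewrite subr0 => /(_ le0); rewrite pmulr_lge0 // lt_def sumr_ge0 // andbT.
  rewrite psumr_eq0 // -has_predC; case/set0Pn: g_n0 => w ws; apply/hasP; exists w.
    by rewrite mem_index_enum.
  by rewrite /= ws gt_eqF //; move: ws; rewrite inE.
have [lt_i|le_i] := ltnP i (size T); last first.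
  rewrite {1 2}/t !ltnNge le_i (leqW le_i) /= subr0 mulr_ge0 // sumr_ge0 //.
pose U := [set u in take i.+1 T].
have inU u : (u \in U) = (u \in take i.+1 T) by rewrite inE.
have size_take : size (take i.+1 T) = i.+1 by rewrite size_takel.
have -> : \sum_(j < i.+1) t j = \sum_(u in U) g u.
  rewrite (eq_bigl (mem (take i.+1 T))) => [|u]; last by rewrite inU.
  rewrite -big_uniq ?take_uniq // (big_nth u0) size_take big_mkord /=.
  apply: eq_bigr => j _; rewrite nth_take ?ltn_ord // /t.
  by rewrite (leq_trans (ltn_ord j) lt_i).
apply: flow.
- apply/set0Pn; exists (nth u0 (take i.+1 T) i).
  by rewrite inU mem_nth // size_take.
- by apply/subsetP => u; rewrite inU => /mem_take; rewrite memT.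
- rewrite {2}/t lt_i /t; case: ifP => // lt_i1.
  by apply: T_anti; rewrite leqnSn.
- move=> u; rewrite inU => /(nthP u0)[j]; rewrite size_take => lt_j <-.
  rewrite nth_take // /t lt_i; apply: T_anti; rewrite lt_i andbT.
  exact: lt_j.
move=> v; rewrite inU => vU; have [vT|] := boolP (v \in T); last first.
  by rewrite memT => /g0 ->.
have : v \in drop i.+1 T.
  by move: vT; rewrite -{1}(cat_take_drop i.+1 T) mem_cat (negbTE vU).
case/(nthP u0) => j; rewrite size_drop nth_drop ltn_subRL => lt_j <-.
by rewrite /t (leq_ltn_trans _ lt_j) ?leq_addr //; apply: T_anti; rewrite leq_addr.
Qed.

(** The extremal case is a path of four vertices with a free end and a zero boundary value beyond
    the other end. Its least eigenvalue is 2 - 2 cos(pi/9), about 0.1206, slightly above 1/9. For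
    two vertices it is (3 - sqrt 5)/2, about 0.38, which leaves room for 1/3 below. *)
Lemma subsolution_value4 : (#|supp| <= 4)%N -> 1 / 9 <= m.
Proof.
have [t [t0_gt0 t_ge0 t_0 tm]] := decreasing_rearrangement => N4.
rewrite leNgt; apply/negP => m9.
have := tm 0%N; have := tm 1%N; have := tm 2%N; have := tm 3%N.
rewrite !big_ord_recr !big_ord0 /= !add0r (t_0 4) //.
have := t_ge0 1%N; have := t_ge0 2%N; have := t_ge0 3%N.
move: t0_gt0; move: (t 0%N) (t 1%N) (t 2%N) (t 3%N) => a0 a1 a2 a3 p0 p3 p2 p1.
have h s : 0 <= s -> m * s <= 1 / 9 * s by move=> s0; rewrite ler_wpM2r // ltW.
have := h (a0 + a1 + a2 + a3); have := h (a0 + a1 + a2); have := h (a0 + a1).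
by have := h a0; lra.
Qed.

Lemma subsolution_value2 : (#|supp| <= 2)%N -> 1 / 3 <= m.
Proof.
have [t [t0_gt0 t_ge0 t_0 tm]] := decreasing_rearrangement => N2.
rewrite leNgt; apply/negP => m3.
have := tm 0%N; have := tm 1%N.
rewrite !big_ord_recr !big_ord0 /= !add0r (t_0 2) //; have := t_ge0 1%N.
move: t0_gt0; move: (t 0%N) (t 1%N) => a0 a1 p0 p1.
have h s : 0 <= s -> m * s <= 1 / 3 * s by move=> s0; rewrite ler_wpM2r // ltW.
by have := h (a0 + a1); have := h a0; lra.
Qed.

(** If the quotient of [y] were below the second eigenvalue, then [g], orthogonal to [y] also for
    the form because the supports are not adjacent, would be an eigenfunction. *)
Lemma separated_rayleigh_ge y : (1 < #|V|)%N -> m = mu R e 2 ->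
  (forall u, 0 < g u -> y u = 0) -> (forall u v, 0 < g u -> e u v -> y v = 0) ->
  m * dotf y y <= dotf (kapp lap y) y.
Proof.
move=> V1; rewrite /mu laplacian_kernel => mE y0 y0'; rewrite leNgt; apply/negP => lt_y.
have pos u : (g u == 0) = false -> 0 < g u by move=> gu; rewrite lt_def g_ge0 gu.
have gy : dotf g y = 0.
  rewrite /dotf big1 // => u _; case: (eqVneq (g u) 0) => [->|/negbTE/pos/y0 ->].
    by rewrite mul0r.
  by rewrite mulr0.
have gay : dotf (kapp lap g) y = 0.
  rewrite /dotf big1 // => u _; have [->|yu] := eqVneq (y u) 0; first by rewrite mulr0.
  rewrite kapp_lap big1 ?mul0r // => v _.
  have gu : g u = 0.
    by apply/eqP; apply: contraNT yu => /negbTE/pos/y0 ->.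
  case: (boolP (e u v)) => uv; last by rewrite mul0r.
  suff -> : g v = 0 by rewrite gu subr0 mulr0.
  apply/eqP; apply: contraNT yu => /negbTE/pos gv; rewrite symE in uv.
  by rewrite (y0' _ _ gv uv).
(* At a zero [v] of [g] next to its support the Laplacian of [g] is negative, so [g] is no
   eigenfunction. *)
have [u [v [us vs uv]]] := cutV (subsetT supp) g_n0 g_nT.
rewrite inE in us; rewrite inE in_setT andbT in vs.
rewrite mE in lt_y; have := subsolution_form; rewrite {1}mE => le_g.
have := second_eigenfunction lap_sym V1 lt_y le_g gay gy v.
rewrite /= (g0 vs) mulr0 kapp_lap => /eqP; apply/negP.
rewrite lt_eqF // (bigD1 u) //= symE uv mul1r (g0 vs) sub0r.
rewrite -oppr_gt0 opprD opprK ltr_wpDr // oppr_ge0.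
by apply: sumr_le0 => w _; rewrite sub0r mulr_ge0_le0 ?ler0n // oppr_le0.
Qed.

End Subsolution.

(* The Rayleigh quotient of the function 4 at [s], 7 at [k], 8 on [K :\ k] is
   at most (25 + t) / (65 + 64 t) with t = |K| - 1, which is less than 1/9 for
   t = 3. *)
Lemma rayleigh_test (s b k : V) (B K : {set V}) : irreflexive e ->
  s \notin B -> s \notin K -> k \in K -> [disjoint K & B] ->
  (forall u v, u \in B -> v \notin B -> e u v -> u = b /\ v = s) ->
  (forall u v, u \in K -> v \notin K -> e u v -> u = k /\ v = s) ->
  exists y : V -> R, [/\ forall u, u \in B -> y u = 0,
    65 + 64 * #|K|.-1%:R <= dotf y y &
    dotf (kapp lap y) y <= 25 + #|K|.-1%:R].
Proof.
move=> irrE sB sK kK disKB exitB exitK.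
have KB u : u \in K -> u \in B = false by move=> uK; exact: (disjointFr disKB uK).
have sk : s != k by apply: contraNneq sK => ->.
(* All vertices outside [B] and [K] share the value 4 of [s], so only three kinds of edges
   contribute: from [s] to [b] (16), from [s] to [k] (9), and from [k] into the rest of [K] (1
   each). *)
pose y u : R := if u \in B then 0 else if u == k then 7 else if u \in K then 8 else 4.
have cardK : #|K :\ k| = #|K|.-1 by rewrite (cardsD1 k K) kK.
exists y; split.
- by move=> u uB; rewrite /y uB.
- apply: le_trans (_ : \sum_u (16 * (u \in [set s])%:R + 49 * (u \in [set k])%:R
      + 64 * (u \in K :\ k)%:R) <= _); last first.
    apply: ler_sum => u _; rewrite !inE /y.
    have [->|us] := eqVneq u s.
      by rewrite (negbTE sB) (negbTE sk) (negbTE sK) /=; lra.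
    have [->|uk] := eqVneq u k; first by rewrite (KB k) //=; lra.
    have [uK|uK] := boolP (u \in K); first by rewrite (KB u) //=; lra.
    by case: ifP => _ /=; lra.
  by rewrite !big_split !sum_indicator !cards1 cardK /=; lra.
have : 2 * dotf (kapp lap y) y <= \sum_u \sum_v
    (16 * ((u \in [set s])%:R * (v \in [set b])%:R)
   + 16 * ((u \in [set b])%:R * (v \in [set s])%:R)
   + 9 * ((u \in [set s])%:R * (v \in [set k])%:R)
   + 9 * ((u \in [set k])%:R * (v \in [set s])%:R)
   + 1 * ((u \in [set k])%:R * (v \in K :\ k)%:R)
   + 1 * ((u \in K :\ k)%:R * (v \in [set k])%:R)).
  rewrite lap_form; apply: ler_sum => u _; apply: ler_sum => v _.
  have nn (p q : bool) : 0 <= p%:R * q%:R :> R by rewrite mulr_ge0.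
  have := nn (u \in [set s]) (v \in [set b]); have := nn (u \in [set b]) (v \in [set s]).
  have := nn (u \in [set s]) (v \in [set k]); have := nn (u \in [set k]) (v \in [set s]).
  have := nn (u \in [set k]) (v \in K :\ k); have := nn (u \in K :\ k) (v \in [set k]).
  have [uv|_] := boolP (e u v); last by rewrite mul0r; lra.
  rewrite mul1r /y; have vu : e v u by rewrite symE.
  have [uB|uB] := boolP (u \in B); have [vB|vB] := boolP (v \in B).
  - by rewrite subrr expr0n /=; lra.
  - have [-> ->] := exitB u v uB vB uv.
    by rewrite !set11 (negbTE sk) (negbTE sK) /=; lra.
  - have [-> ->] := exitB v u vB uB vu.
    by rewrite !set11 (negbTE sk) (negbTE sK) /=; lra.
  have [uK|uK] := boolP (u \in K); have [vK|vK] := boolP (v \in K).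
  - have [uk|uk] := eqVneq u k; have [vk|vk] := eqVneq v k.
    + by rewrite uk vk irrE in uv.
    + by rewrite uk !inE eqxx vk vK /=; lra.
    + by rewrite vk !inE eqxx uk uK /=; lra.
    + by rewrite subrr expr0n /=; lra.
  - have [-> ->] := exitK u v uK vK uv.
    by rewrite !set11 eqxx (negbTE sk) /=; lra.
  - have [-> ->] := exitK v u vK uK vu.
    by rewrite !set11 eqxx (negbTE sk) /=; lra.
  rewrite (_ : (u == k) = false); last by apply: contraNF uK => /eqP ->.
  rewrite (_ : (v == k) = false); last by apply: contraNF vK => /eqP ->.
  by rewrite subrr expr0n /=; lra.
have sum6 (F1 F2 F3 F4 F5 F6 : V -> V -> R) :
  \sum_u \sum_v (F1 u v + F2 u v + F3 u v + F4 u v + F5 u v + F6 u v) =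
  \sum_u \sum_v F1 u v + \sum_u \sum_v F2 u v + \sum_u \sum_v F3 u v +
  \sum_u \sum_v F4 u v + \sum_u \sum_v F5 u v + \sum_u \sum_v F6 u v.
  by rewrite -!big_split; apply: eq_bigr => u _; rewrite -!big_split.
by rewrite sum6 !sum2_indicator !cards1 cardK; lra.
Qed.

End Laplacian.

(** * Centre and characteristic set *)

Section SetDist.
Variables (V : finType) (e : rel V).
Implicit Types (S C : {set V}) (s c : V).

Lemma set_dist_le S C s c : s \in S -> c \in C -> (set_dist e S C <= dist e s c)%N.
Proof.
move=> sS cC; apply: leq_trans (@bigminn_le _ (mem S) _ _ s sS) _.
exact: (@bigminn_le _ (mem C)).
Qed.

Lemma set_dist_attained S C : S != set0 -> C != set0 ->
  exists s c, [/\ s \in S, c \in C & dist e s c = set_dist e S C].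
Proof.
case/set0Pn=> s sS /set0Pn[c cC].
have le_V x y : (dist e x y <= #|V|)%N.
  by rewrite /dist -[leqRHS](size_iota 0) find_size.
(* If the minimum is its start value, every distance equals it, being at most that. *)
have top : set_dist e S C = #|V| ->
    exists s c, [/\ s \in S, c \in C & dist e s c = set_dist e S C].
  move=> E; exists s, c; split=> //; apply/eqP.
  by rewrite eqn_leq set_dist_le // {1}E le_V.
case: (bigminn_attained (fun x => x \in S)
    (fun x => \big[minn/#|V|]_(y in C) dist e x y) #|V|) => [//|[x xS xE]].
case: (bigminn_attained (fun y => y \in C) (dist e x) #|V|) => [yE|[y yC yE]].
  by apply: top; rewrite /set_dist xE.
by exists x, y; rewrite /set_dist xE -yE.
Qed.

Lemma dist_gt0 s c : connect e s c -> s != c -> (0 < dist e s c)%N.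
Proof.
case/dist_path => p [pe pc <-]; case: p pe pc => //= _ ->.
by rewrite eqxx.
Qed.

End SetDist.

Section Branches.
Variables (R : realType) (V : finType) (e : rel V).
Hypotheses (symE : symmetric e) (connE : is_connected e) (uniqE : unique_entry e).
Implicit Types (S C : {set V}) (s c : V).

Lemma connected_cut : cut_connected e setT.
Proof.
move=> Z _ /set0Pn[x xZ] ZT.
have /subsetPn[y _ yZ] : ~~ (setT \subset Z) by rewrite subTset.
have [u [v [uZ vZ uv]]] := connect_exit (connE x y) xZ yZ.
by exists u, v; rewrite inE vZ inE.
Qed.

Lemma component_unique_exit s x b u v : x != s -> e s b ->
  b \in component e (~: [set s]) x -> u \in component e (~: [set s]) x ->
  v \notin component e (~: [set s]) x -> e u v -> u = b /\ v = s.
Proof.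
move=> xs sb bB uB vB uv; have vs := component_exit xs uB uv vB.
split=> //; rewrite vs symE in uv; apply: uniqE uv sb _.
move: uB bB; rewrite !inE => xu; apply: connect_trans.
by rewrite edges_in_csym.
Qed.

Lemma component_neighbour s x : x != s ->
  exists2 k, e s k & k \in component e (~: [set s]) x.
Proof.
move=> xs; have xK := mem_component e (~: [set s]) x.
have sK : s \notin component e (~: [set s]) x.
  have xS : x \in ~: [set s] by rewrite !inE.
  by apply/negP => /(subsetP (component_sub e xS)); rewrite !inE eqxx.
have [u [v [uK vK uv]]] := connect_exit (connE x s) xK sK.
by exists u; rewrite // symE -(component_exit xs uK uv vK).
Qed.

Lemma negative_neighbour (F : V -> R) c w : \sum_v (e c v)%:R * F v = 0 ->
  e c w -> F w != 0 -> exists2 v, e c v & F v < 0.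
Proof.
move=> sum0 cw Fw; apply/exists_inP; apply: contraNT Fw => /exists_inPn h.
have term_ge0 v : 0 <= (e c v)%:R * F v.
  case: (boolP (e c v)) => cv; last by rewrite mul0r.
  by rewrite mul1r leNgt h.
have /eqP := psumr_eq0P (fun v _ => term_ge0 v) sum0 (erefl : xpredT w).
by rewrite cw mul1r.
Qed.

(** The sign of the Fiedler vector is chosen. If it vanishes at [c], then [c] has neighbours of both
    signs, and [s] lies behind at most one of them. Otherwise the other end of the characteristic
    edge serves. Since [h c] is nonnegative, truncating [h] to its negative part on that branch
    gives a subsolution. *)
Lemma negative_branch C (f : 'cV[R]_#|V|) s c : is_fiedler e f -> characteristic_set_of e f C ->
  c \in C -> s != c -> (forall c', c' \in C -> (dist e s c <= dist e s c')%N) ->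
  exists (h : V -> R) c', [/\ kapp (lap R e) h =1 (fun u => mu R e 2 * h u),
    e c c', s \notin component e (~: [set c]) c', h c' < 0 & 0 <= h c].
Proof.
move=> fied Cf cC sc minC; have [eigf _] := fiedler_eigenfunction fied.
have eigNf : kapp (lap R e) (fun u => - 1 * entry f u) =1
    (fun u => mu R e 2 * (- 1 * entry f u)).
  by move=> u; rewrite kappZ eigf mulrCA.
case: Cf => [[v [w [fv vw fw CE]]]|[fn0 [u [v [uv fu fv CE]]]]].
  have cv : c = v by move: cC; rewrite CE inE => /eqP.
  subst v; have sum0 : \sum_v (e c v)%:R * entry f v = 0.
    have := eigf c; rewrite kapp_lap fv mulr0 => E.
    apply/eqP; rewrite -oppr_eq0 -[X in _ == X]E -sumrN; apply/eqP/eq_bigr => v _.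
    by rewrite sub0r mulrN.
  have [w1 cw1 fw1] := negative_neighbour sum0 vw fw.
  have [w2 cw2 fw2] : exists2 w, e c w & - 1 * entry f w < 0.
    apply: (negative_neighbour _ vw); last by rewrite mulN1r oppr_eq0.
    under eq_bigr => v _ do rewrite mulrCA.
    by rewrite -big_distrr /= sum0 mulr0.
  have [sw1|sw1] := boolP (s \in component e (~: [set c]) w1); last first.
    by exists (entry f), w1; rewrite fv.
  exists (fun u => - 1 * entry f u), w2; rewrite fv mulr0; split=> //.
  apply/negP => sw2; have w12 : w1 = w2.
    apply: uniqE cw1 cw2 _; move: sw1 sw2; rewrite !inE => sw1.
    by rewrite edges_in_csym //; apply: connect_trans.
  by move: fw2; rewrite -w12 mulN1r oppr_lt0 ltNge ltW.
(* The first step from [c] towards [s] decreases the distance, so by the choice of [c] it does not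
   lead into [C]. *)
have far c' : c' \in C -> e c c' -> s \notin component e (~: [set c]) c'.
  move=> c'C cc'; apply/negP; rewrite inE => sc'.
  have := dist_step symE (connE c s); rewrite eq_sym => /(_ sc)[z [cz sz lt_z]].
  rewrite inE in sz.
  have zc' : z = c'.
    by apply: uniqE cz cc' _; rewrite edges_in_csym //; apply: connect_trans sc' sz.
  by move: lt_z; rewrite zc' -(dist_sym symE (connE s c')) -(dist_sym symE (connE s c)) ltnNge minC.
have : (c == u) || (c == v) by move: cC; rewrite CE !inE.
case/orP => /eqP E; subst c.
  exists (entry f), v; split=> //; last exact: ltW.
  by apply: far; rewrite // CE !inE eqxx orbT.
exists (fun u => - 1 * entry f u), u; split=> //.
- by rewrite symE.
- by apply: far; rewrite 1?symE // CE !inE eqxx.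
- by rewrite mulN1r oppr_lt0.
- by rewrite mulN1r oppr_ge0 ltW.
Qed.

End Branches.

(** * Playing the adjacency bounds against the Laplacian bounds *)

Section Main.
Variables (R : realType) (V : finType) (e : rel V).
Hypotheses (treeE : is_tree e) (V2 : (2 <= #|V|)%N).
Let symE : symmetric e. Proof. by case: treeE => -[]. Qed.
Let irrE : irreflexive e. Proof. by case: treeE => -[]. Qed.
Let connE : is_connected e. Proof. by case: treeE. Qed.
Let acycE : is_acyclic e. Proof. by case: treeE. Qed.
Let uniqE : unique_entry e. Proof. exact: acyclic_unique_entry. Qed.
Local Notation rad X := (spectral_radius (adjacency R (@induced V e X))).

(** The connected set [S] could enter the branch only through [b], which is excluded; so the branch
    is a whole component of the complement of [S]. *)
Lemma center_component S s c b : adjacency_center R e S -> s \in S -> c != s ->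
  e s b -> b \in component e (~: [set s]) c -> c \notin S -> b \notin S ->
  rad (component e (~: [set s]) c) <= lambda R e 2.
Proof.
case/minsetP => /andP[/andP[_ subS] /forall_inP bounds] _ sS cs sb bB cS bS.
have notS t : t \in component e (~: [set s]) c -> t \notin S.
  move=> tB; apply/negP => tS; have st := forall_inP (forall_inP subS s sS) t tS.
  have sB : s \in ~: component e (~: [set s]) c.
    rewrite inE; apply/negP => /(subsetP (component_sub e _)); rewrite !inE eqxx.
    by rewrite cs => /(_ isT).
  have [|u [v [uB vB /and3P[uS vS uv]]]] := connect_exit st sB.
    by rewrite inE tB.
  rewrite !inE negbK in uB vB; rewrite symE in uv.
  have vB' : v \in component e (~: [set s]) c by rewrite inE.
  have uB' : u \notin component e (~: [set s]) c by rewrite inE.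
  have [vb _] := component_unique_exit symE uniqE cs sb bB vB' uB' uv.
  by rewrite -vb vS in bS.
have cC : c \in ~: S by rewrite inE.
have BE : component e (~: S) c = component e (~: [set s]) c.
  apply/eqP; rewrite eqEsubset; apply/andP; split.
    apply/subsetP => t; rewrite !inE; apply: connect_sub => x y /and3P[xS yS xy].
    apply: connect1; rewrite /edges_in /= !inE in xS yS *; rewrite xy andbT.
    by apply/andP; split; [apply: contraNneq xS => -> | apply: contraNneq yS => ->].
  apply: contraT => nsub.
  have cB : c \in ~: [set s] by rewrite !inE.
  have sub : component e (~: S) c :&: component e (~: [set s]) c
      \subset component e (~: [set s]) c by exact: subsetIr.
  have [||u [v [uZ vZ uv]]] := component_cut symE cB sub.
  - by apply/set0Pn; exists c; rewrite inE !mem_component.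
  - by apply: contra nsub => /eqP/setIidPr.
  move: uZ vZ; rewrite in_setI in_setD in_setI => /andP[uS uB] /andP[+ vB].
  rewrite vB andbT => /negP[]; apply: component_edge uS _ _ uv.
    by rewrite inE notS.
  by rewrite inE notS.
by rewrite -BE; apply: bounds; apply/imsetP; exists c.
Qed.

Lemma branch_sizes S C s c : adjacency_center R e S -> characteristic_set R e C ->
  (0 < set_dist e S C)%N -> s \in S -> c \in C -> dist e s c = set_dist e S C ->
  (6 <= #|component e (~: [set s]) c|)%N /\
  (6 <= #|~: component e (~: [set s]) c|)%N.
Proof.
move=> adjS [f [fied charC]] d_gt0 sS cC dE; set B := component _ _ _.
have sNC : s \notin C.
  apply: contraTN d_gt0 => sC; rewrite -leqNgt (leq_trans (set_dist_le e sS sC)) //.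
  exact: (@dist_le _ e s [::]).
have cNS : c \notin S.
  apply: contraTN d_gt0 => cS; rewrite -leqNgt (leq_trans (set_dist_le e cS cC)) //.
  exact: (@dist_le _ e c [::]).
have cs : c != s by apply: contraNneq cNS => ->.
have sc : s != c by rewrite eq_sym.
have [b [sb bB lt_b]] := dist_step symE (connE s c) sc.
rewrite -/B in bB.
(* [b] is closer to [c] than the minimal distance allows for members of [S]. *)
have bNS : b \notin S.
  by apply/negP => bS; move: lt_b; rewrite dE ltnNge set_dist_le.
have radB := center_component adjS sS cs sb bB cNS bNS.
have [K /imsetP[w wS KE] [KB radK]] :=
  other_heavy_component symE V2 irrE uniqE cs sb bB radB.
rewrite -/B in KB radB.
have ws : w != s by move: wS; rewrite !inE.
have cS : c \in ~: [set s] by rewrite !inE.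
have [k sk kK] := component_neighbour symE connE ws; rewrite -KE in kK.
have exitK u v : u \in K -> v \notin K -> e u v -> u = k /\ v = s.
  by move: kK; rewrite KE; exact: component_unique_exit.
have exitB u v : u \in B -> v \notin B -> e u v -> u = b /\ v = s.
  exact: component_unique_exit.
have sB : s \notin B.
  by apply/negP => /(subsetP (component_sub e cS)); rewrite !inE eqxx.
have sK : s \notin K.
  by apply/negP; rewrite KE => /(subsetP (component_sub e wS)); rewrite !inE eqxx.
have disKB : [disjoint K & B].
  rewrite -setI_eq0; apply: contraR KB => /set0Pn[u]; rewrite inE KE => /andP[uK uB].
  by rewrite -(component_eq symE uK) (component_eq symE uB).
have cB : c \in B by exact: mem_component.
have radB0 : 0 <= rad B by exact: radius_ge0.
have le_rad : rad B ^+ 2 <= (#|K|.-1)%:R.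
  have K_gt0 : (0 < #|{: {x : V | x \in K}}|)%N.
    by rewrite card_induced card_gt0; apply/set0Pn; exists k.
  apply: le_trans (_ : rad K ^+ 2 <= _).
    by rewrite lerXn2r ?nnegrE ?(le_trans radB0) // (le_trans radB).
  rewrite -[#|K|]card_induced; apply: radius_sqr_le => //.
  - exact: induced_sym.
  - by move=> u; rewrite /induced irrE.
  - exact: induced_acyclic.
have cutB := induced_cut (component_cut symE cS); rewrite -/B in cutB.
have B_gt0 : (0 < #|B|)%N by rewrite card_gt0; apply/set0Pn; exists c.
have radB_ge : 4 * #|B|%:R - 6 <= rad B ^+ 2 * #|B|%:R.
  have := radius_sqr_ge R (induced_sym symE (X := B)) cutB.
  by move: (rad B) => r; rewrite card_induced; exact.
have radB_gt3 : (6 <= #|B|)%N -> 3 < rad B ^+ 2.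
  have := radius_sqr_gt3 R (induced_sym symE (X := B)) cutB.
  by move: (rad B) => r; rewrite card_induced; exact.
have [h [c' [eigh cc' sD hc' hc]]] :=
  negative_branch symE connE uniqE fied charC cC sc
    (fun c' c'C => leq_trans (eq_leq dE) (set_dist_le e sS c'C)).
set D := component _ _ _ in sD.
have c'D : c' \in D by exact: mem_component.
have c'c : c' != c by apply: contraTneq cc' => ->; rewrite irrE.
have c'S : c' \in ~: [set c] by rewrite !inE.
have cD : c \notin D.
  by apply/negP => /(subsetP (component_sub e c'S)); rewrite !inE eqxx.
(* A way out of [B] passes through [s], which [D] avoids. *)
have DB : D \subset B.
  apply: contraT => nsub.
  have [||u [v [uZ vZ uv]]] := component_cut symE c'S (subsetIl _ B).
  - apply/set0Pn; exists c'; rewrite in_setI c'D /=; apply: contraT => c'B.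
    by move: sD; rewrite -(component_exit cs cB cc' c'B) c'D.
  - by apply: contra nsub => /eqP/setIidPl.
  move: uZ vZ; rewrite in_setI in_setD in_setI => /andP[uD uB] /andP[+ vD].
  rewrite vD /= => vB; have vs := component_exit cs uB uv vB.
  by move: sD; rewrite -vs vD.
(* Otherwise the edge from [b] would bring [s] into [D]. This keeps the support of [g] off the only
   vertex of [B] adjacent to the complement, and saves one vertex in the count. *)
have bD : b \notin D.
  apply: contra sD => bD; apply: (component_edge bD); rewrite ?inE //.
    by apply: contraNneq cD => <-.
  by rewrite symE.
pose g u := if (u \in D) && (h u < 0) then - h u else 0.
have g_ge0 u : 0 <= g u by rewrite /g; case: ifP => // /andP[_ /ltW]; rewrite oppr_ge0.
have g_gt0 u : (0 < g u) = (u \in D) && (h u < 0).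
  by rewrite /g; case: ifP => [/andP[_ hu]|_]; rewrite ?ltxx // oppr_gt0.
have g_ge u : u \in D -> - h u <= g u.
  by rewrite /g => -> /=; case: ltP => // hu; rewrite oppr_le0.
(* Where [g] is positive it equals [- h], and at every neighbour it is at least [- h]: in [D] by
   definition, and outside [D] because the neighbour is [c], where [h] is nonnegative. *)
have gm u : 0 < g u -> kapp (lap R e) g u <= mu R e 2 * g u.
  move=> gu; move: (gu); rewrite g_gt0 => /andP[uD hu].
  have guE : g u = - h u by rewrite /g uD hu.
  rewrite guE mulrN -eigh !kapp_lap -sumrN; apply: ler_sum => v _.
  case: (boolP (e u v)) => uv; last by rewrite !mul0r oppr0.
  rewrite !mul1r guE opprB addrC lerD2r.
  have [/g_ge|vD] := boolP (v \in D); first by rewrite lerNl.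
  by rewrite (component_exit c'c uD uv vD) (le_trans _ hc) // oppr_le0.
pose N := [set u | 0 < g u].
have N_n0 : N != set0 by apply/set0Pn; exists c'; rewrite inE g_gt0 c'D.
have N_nT : N != setT.
  apply/eqP => /setP/(_ s); rewrite !inE g_gt0 (negbTE sD).
  by [].
have NB : N \subset B :\ b.
  apply/subsetP => u; rewrite inE g_gt0 => /andP[uD _].
  rewrite in_setD1 (subsetP DB) // andbT.
  by apply: contraNneq bD => <-.
have card_N : (#|N| <= #|B|.-1)%N.
  by apply: leq_trans (subset_leq_card NB) _; rewrite (cardsD1 b B) bB.
have cutV := connected_cut connE.
have [y [yB yy yay]] := rayleigh_test R symE irrE sB sK kK disKB exitB exitK.
have rayl : mu R e 2 * dotf y y <= dotf (kapp (lap R e) y) y.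
  have mem_NB u : 0 < g u -> u \in B :\ b.
    by move=> gu; apply: (subsetP NB); rewrite inE.
  apply: (separated_rayleigh_ge symE cutV g_ge0 gm) => //.
    by move=> u /mem_NB; rewrite in_setD1 => /andP[_ /yB].
  move=> u v /mem_NB; rewrite in_setD1 => /andP[ub uB] uv; apply: yB.
  by apply: contraNT ub => vB; have [->] := exitB u v uB vB uv.
set r := rad B ^+ 2 in le_rad radB_ge radB_gt3.
have rayl_t : mu R e 2 * dotf y y <= 25 + #|K|.-1%:R by exact: le_trans rayl yay.
have mu_bound m : 0 <= m -> m <= mu R e 2 -> m * (65 + 64 * #|K|.-1%:R) <= 25 + #|K|.-1%:R.
  move=> m0 m_mu; apply: le_trans rayl_t.
  by apply: le_trans (ler_wpM2l m0 yy) (ler_wpM2r (dotf_ge0 y) m_mu).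
(* Write t for |K| - 1. If |B| <= 5, then 1/9 forces t <= 2, hence 4|B| - 6 <= 2|B| and |B| <= 3;
   now 1/3 forces t = 0, hence |B| <= 1, leaving no vertex for the support of [g]. *)
have B6 : (6 <= #|B|)%N.
  rewrite leqNgt ltnS; apply/negP => B5.
  have K3 : (#|K|.-1 <= 2)%N.
    have mu9 : 1 / 9 <= mu R e 2.
      apply: (subsolution_value4 symE cutV g_ge0 gm) => //.
      by apply: leq_trans card_N _; rewrite -ltnS prednK.
    rewrite -ltnS -(ltr_nat R); have := mu_bound (1 / 9) _ mu9.
    have := ler0n R #|K|.-1; lra.
  have B3 : (#|B| <= 3)%N.
    rewrite -ltnS -(ltr_nat R); have r2 : r <= 2%:R by rewrite (le_trans le_rad) ?ler_nat.
    have := ler_wpM2r (ler0n R #|B|) r2; lra.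
  have K1 : (#|K|.-1 <= 0)%N.
    have mu3 : 1 / 3 <= mu R e 2.
      apply: (subsolution_value2 symE cutV g_ge0 gm) => //.
      by apply: leq_trans card_N _; rewrite -ltnS prednK.
    rewrite -ltnS -(ltr_nat R); have := mu_bound (1 / 3) _ mu3.
    have := ler0n R #|K|.-1; lra.
  have B1 : (#|B| < 2)%N.
    rewrite -(ltr_nat R); have r0 : r <= 0%:R by rewrite (le_trans le_rad) ?ler_nat.
    have := ler_wpM2r (ler0n R #|B|) r0; lra.
  move: N_n0; rewrite -card_gt0 ltnNge (leq_trans card_N) //.
  by rewrite -ltnS prednK.
(* Here |K| - 1 > 3, so [K] has at least five vertices, and [s] is the sixth outside [B]. *)
split=> //; have K5 : (3 < #|K|.-1)%N.
  by rewrite -(ltr_nat R) (lt_le_trans (radB_gt3 B6)).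
have sub : s |: K \subset ~: B.
  apply/subsetP => u; rewrite in_setU1 in_setC => /orP[/eqP -> //|uK].
  by rewrite (disjointFr disKB uK).
apply: leq_trans (subset_leq_card sub); rewrite cardsU1 sK add1n ltnS.
by move: K5; case: #|K|.
Qed.

End Main.

Theorem lemma4p4 (R : realType) (V : finType) (e : rel V) (S C : {set V}) :
  is_tree e -> (2 <= #|V|)%N ->
  adjacency_center R e S -> characteristic_set R e C ->
  ((0 < set_dist e S C)%N ->
     forall s c : V, s \in S -> c \in C -> dist e s c = set_dist e S C ->
       let B := component e (~: [set s]) c in
       let H := ~: B in
       (6 <= #|B|)%N /\ (6 <= #|H|)%N)
  /\ ([disjoint S & C] -> (12 <= #|V|)%N).
Proof.
move=> treeE V2 adjS charC; split=> [d_gt0 s c sS cC dE /=|disSC].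
  exact: branch_sizes adjS charC d_gt0 sS cC dE.
have S0 : S != set0 by case/minsetP: adjS => /andP[/andP[]].
have C0 : C != set0.
  case: charC => f [_ [[v [w [_ _ _ ->]]]|[_ [u [v [_ _ _ ->]]]]]].
    by apply/set0Pn; exists v; rewrite inE.
  by apply/set0Pn; exists u; rewrite !inE eqxx.
have [s [c [sS cC dE]]] := set_dist_attained e S0 C0.
have d_gt0 : (0 < set_dist e S C)%N.
  rewrite -dE dist_gt0 //; first by case: treeE.
  by apply: contraTneq sS => ->; rewrite (disjointFl disSC).
have [B6 H6] := branch_sizes treeE V2 adjS charC d_gt0 sS cC dE.
by rewrite -(cardsC (component e (~: [set s]) c)) (leq_add B6 H6).
Qed.
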